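(* Let $n\ge2$ and let $X=(X_1,\ldots,X_n)$ be an $n$-dimensional L\'evy process with $X(0)=0$, where $X_1$ has no negative jumps and is not a subordinator, and $X_2,\ldots,X_n$ are subordinators none of which is identically zero (the coordinates may be dependent). Let $\varphi$ be its Laplace exponent, $E[e^{-\alpha^TX(t)}]=e^{\varphi(\alpha)t}$ for $\alpha\in[0,\infty)^n$. Put $Y_i=X_1+\cdots+X_i$ ($1\le i\le n$), assume $EY_n(1)<0$, let $Z_i(t)=Y_i(t)-\inf_{0\le s\le t}Y_i(s)$, and let $Z^*=(Z_1^*,\ldots,Z_n^* )$ be a random vector with the stationary (steady-state) distribution of $(Z_1(t),\ldots,Z_n(t))$. Define $\tilde\varphi(\alpha)=\varphi(\alpha_1+\cdots+\alpha_n,\alpha_2+\cdots+\alpha_n,\ldots,\alpha_n)$. Then for all $\alpha\in\mathbb{R}^n$ with $\sum_{i=k}^n\alpha_i\ge0$ for every $k=1,\ldots,n$, \[ \tilde\varphi(\alpha)\,E e^{-\alpha^TZ^*}=\sum_{k=1}^{n-1}\alpha_k f_k(\alpha_{k+1},\ldots,\alpha_n)+\alpha_nf_n, \] where $f_n=-EY_n(1)$ is a constant and, for $k=n-1,n-2,\ldots,1$, the functions $f_k$ are given recursively by \[ f_k(\alpha_{k+1},\ldots,\alpha_n)=\frac{\sum_{i=k+1}^{n-1}\alpha_if_i(\alpha_{i+1},\ldots,\alpha_n)+\alpha_nf_n}{\sum_{i=k+1}^n\alpha_i-\psi_k(\alpha_{k+1}+\cdots+\alpha_n,\ldots,\alpha_{n-1}+\alpha_n,\alpha_n)},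 \] an empty sum being zero.
   Context: A subordinator is a nondecreasing L\'evy process. For $k=1,\ldots,n-1$ and $\gamma_{k+1},\ldots,\gamma_n\ge0$, $\psi_k(\gamma_{k+1},\ldots,\gamma_n)$ denotes the unique nonnegative $\beta$ with $\varphi(\beta,\ldots,\beta,\gamma_{k+1},\ldots,\gamma_n)=0$ ($k$ copies of $\beta$); when the $\gamma$'s are not all zero it is the unique positive root, and when they are all zero it equals $0$ (under $EY_n(1)<0$).
   Formalization: The identity is stated only for those α at which every denominator in the recursion for f_1,…,f_{n-1} is nonzero; elsewhere (for example α_n = 0, where f_{n-1} = 0/0) the given quotient formula is undefined and would need a limiting value. *)

(* Defs.v *)
From HB Require Import structures.
From mathcomp Require Import all_boot all_order all_algebra.
From mathcomp Require Import all_classical all_reals all_analysis.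
Set Implicit Arguments. Unset Strict Implicit. Unset Printing Implicit Defensive.
Import Order.TTheory GRing.Theory Num.Theory.
Import numFieldNormedType.Exports.
Local Open Scope classical_set_scope.
Local Open Scope ring_scope.

Section Paths.
Context (R : realType).

Definition cadlag (f : R -> R) : Prop :=
  (forall t, 0 <= t -> f x @[x --> t^'+] --> f t) /\
  (forall t, 0 < t -> cvg (f x @[x --> t^'-])).

Definition no_negative_jumps (f : R -> R) : Prop :=
  forall t, 0 < t -> lim (f x @[x --> t^'-]) <= f t.

Definition nondecreasing_on_Rplus (f : R -> R) : Prop :=
  forall s t, 0 <= s -> s <= t -> f s <= f t.

End Paths.

Section Process.
Context (d : measure_display) (Omega : measurableType d) (R : realType)
  (P : probability Omega R) (n : nat).

Implicit Types (X : 'I_n -> R -> Omega -> R).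

(* the law of X(s+t) - X(s) equals the law of X(t) (as random vectors in R^n;
   equality on measurable rectangles, a pi-system generating the Borel sets) *)
Definition stationary_increments X : Prop :=
  forall s t, 0 <= s -> 0 <= t ->
  forall B : 'I_n -> set R, (forall i, measurable (B i)) ->
  P [set w | forall i, B i (X i (s + t) w - X i s w)] =
  P [set w | forall i, B i (X i t w)].

Definition independent_increments X : Prop :=
  forall (m : nat) (t : nat -> R), 0 <= t 0%N ->
  (forall j, (j < m)%N -> t j <= t j.+1) ->
  forall B : 'I_m -> 'I_n -> set R, (forall j i, measurable (B j i)) ->
  P (\bigcap_(j in [set: 'I_m])
       [set w | forall i, B j i (X i (t j.+1) w - X i (t j) w)]) =
  \big[*%E/1%E]_(j < m)
     P [set w | forall i, B j i (X i (t j.+1) w - X i (t j) w)].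

Definition levy_process X : Prop :=
  [/\ (forall i t, measurable_fun setT (X i t)),
      (forall i w, X i 0 w = 0),
      (forall i w, cadlag (fun t => X i t w)),
      stationary_increments X & independent_increments X].

Definition subordinator_coord X (i : 'I_n) : Prop :=
  {ae P, forall w, nondecreasing_on_Rplus (fun t => X i t w)}.

Definition identically_zero_coord X (i : 'I_n) : Prop :=
  forall t, 0 <= t -> {ae P, forall w, X i t w = 0}.

Definition no_negative_jumps_coord X (i : 'I_n) : Prop :=
  {ae P, forall w, no_negative_jumps (fun t => X i t w)}.

Definition laplace_exponent X (phi : ('I_n -> R) -> R) : Prop :=
  forall alpha : 'I_n -> R, (forall i, 0 <= alpha i) ->
  forall t, 0 <= t ->
  (\int[P]_w (expR (- \sum_i alpha i * X i t w))%:E = (expR (phi alpha * t))%:E)%E.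

(* Y_{k+1} = X_1 + ... + X_{k+1}  (0-indexed k) *)
Definition Ysum X (k : nat) (t : R) (w : Omega) : R :=
  \sum_(j < n | (j <= k)%N) X j t w.

Definition Zref X (k : nat) (t : R) (w : Omega) : R :=
  Ysum X k t w - inf [set Ysum X k s w | s in `[0, t]].

(* Zs has the steady-state distribution of (Z_1(t),...,Z_n(t)):
   the law of Z(t) converges weakly to the law of Zs as t -> +oo *)
Definition steady_state X (Zs : 'I_n -> Omega -> R) : Prop :=
  forall g : 'rV[R]_n -> R, continuous g -> (exists M, forall v, `|g v| <= M) ->
  (\int[P]_w (g (\row_i Zref X i t w))%:E)%E @[t --> +oo] -->
  (\int[P]_w (g (\row_i Zs i w))%:E)%E.

End Process.

Section Recursion.
Context (R : realType) (n : nat) (phi : ('I_n -> R) -> R).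

(* psi_k(gamma_{k+1},...,gamma_n): the gamma's sit at 0-indexed positions
   k..n-1 of gamma, the k copies of beta at positions 0..k-1. *)
Definition psi (k : nat) (gamma : 'I_n -> R) : R :=
  if `[< forall i : 'I_n, (k <= i)%N -> gamma i = 0 >] then 0
  else xget 0 [set b | 0 < b /\ phi (fun i => if (i < k)%N then b else gamma i) = 0].

(* alpha_{p+1} in the paper's 1-indexed notation is av alpha p *)
Definition av (alpha : 'I_n -> R) (p : nat) : R :=
  if (insub p : option 'I_n) is Some i then alpha i else 0.

(* tailn alpha k = alpha_{k+1} + ... + alpha_n (paper indexing) *)
Definition tailn (alpha : 'I_n -> R) (k : nat) : R :=
  \sum_(j < n | (k <= j)%N) alpha j.

Definition tailv (alpha : 'I_n -> R) : 'I_n -> R := fun i => tailn alpha i.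

Definition phit (alpha : 'I_n -> R) : R := phi (tailv alpha).

Variables (c : R) (alpha : 'I_n -> R).

(* denominator of f_k (paper index k, 1 <= k <= n-1):
   (alpha_{k+1}+...+alpha_n) - psi_k(alpha_{k+1}+...+alpha_n, ..., alpha_n) *)
Definition fden (k : nat) : R := tailn alpha k - psi k (tailv alpha).

(* fnum (n-k) = sum_{i=k+1}^{n-1} alpha_i f_i + alpha_n f_n, with f_n = c *)
Fixpoint fnum (dd : nat) : R :=
  match dd with
  | 0 => 0
  | dd'.+1 => if dd' == 0%N then av alpha n.-1 * c
              else av alpha (n - dd').-1 * (fnum dd' / fden (n - dd')) + fnum dd'
  end.

Definition fk (k : nat) : R := fnum (n - k) / fden k.

Definition rhs : R := \sum_(1 <= k < n) av alpha k.-1 * fk k + av alpha n.-1 * c.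

End Recursion.

(* Main.v *)
(* Sample X on a grid of mesh delta and run the Lindley recursion
   W_i(j+1) = max(0, W_i(j) + y_i(j)), where y_i(j) is the increment of
   X_1 + ... + X_i over the j-th cell; let L_i(j) be the amount by which
   coordinate i is pushed back to 0.  Since X_2, ..., X_n are nondecreasing, the
   W_i increase with i, and coordinate i is pushed only when W_1, ..., W_i all
   vanish afterwards.  By independence of the increments, the expectation of the
   one-step change of exp(- sum_i alpha_i W_i) is, up to an error,
     delta phit(alpha) E exp(- sum_i alpha_i W_i)
       - sum_i alpha_i E [exp(- sum_{l > i} alpha_l W_l) L_i].
   The error is of second order in L_1; as X_1 has no negative jumps, a drop of
   fixed size within one cell has probability o(delta), and the total error over
   a bounded time interval vanishes with delta.  On [0, K] the left-hand sides
   telescope, so dividing by K and letting K tend to infinity, with delta small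
   enough for W to follow Z, gives
     phit(alpha) E exp(- sum_i alpha_i Z*_i) = lim_K sum_i alpha_i p_i,
   where the pushing rate p_i depends only on alpha_{i+1}, ..., alpha_n.  The
   choice alpha = (0, ..., 0, beta) with beta -> 0 gives lim p_n = - E Y_n(1), and
   replacing alpha_1, ..., alpha_k so that the argument of phi becomes
   (psi_k, ..., psi_k, alpha_{k+1} + ... + alpha_n, ..., alpha_n) kills the
   left-hand side and determines lim p_k from the limits of the p_i, i > k. *)
Require Import Defs.
From HB Require Import structures.
From mathcomp Require Import all_boot all_order all_algebra.
From mathcomp Require Import all_classical all_reals all_analysis.
From mathcomp Require Import measurable_realfun zify ring lra.
Import Order.TTheory GRing.Theory Num.Theory.
Import numFieldNormedType.Exports.
Local Open Scope classical_set_scope.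
Local Open Scope ring_scope.

(** * The Lindley recursion *)

(** The discrete recursion replaces stochastic calculus: the regulator becomes a finite sum of
    pushes, and the one-step identity uses independence only between a cell and the cells before it.
    The obstacle is the order of limits. Per unit time, the error of the telescoped identity is
    small uniformly in the horizon [K], apart from a boundary term [1 / K]; the distance between the
    recursion and [Z] is controlled only for fixed [K]. Hence a mesh [1 / mK K] is chosen for each
    [K], and this one sequence serves every [alpha]. Along it, each admissible [alpha] gives the
    limit of one linear combination of pushing rates. That the individual rates converge is not
    known beforehand: it comes out of solving these relations, from the last coordinate down. The
    steady state enters as a limit in law, through time averages of the transform of [Z(t)]. All
    exponentials stay below 1 because the tail sums of [alpha] are nonnegative and the reflected
    coordinates increase with their index. *)

Section TailSums.
Context {R : realType} {n : nat}.
Implicit Types (alpha F : 'I_n -> R) (u : nat -> R).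

Lemma sum_ord_geS F (k : 'I_n) :
  \sum_(l < n | (k <= l)%N) F l = F k + \sum_(l < n | (k < l)%N) F l.
Proof.
rewrite (bigD1 k)//=; congr (_ + _); apply: eq_bigl => l.
by rewrite ltn_neqAle eq_sym andbC.
Qed.

Lemma sum_ord_ge_oversize F k : (n <= k)%N ->
  \sum_(l < n | (k <= l)%N) F l = 0.
Proof.
move=> nk; rewrite big1// => l kl; exfalso.
by have := leq_trans nk kl; rewrite leqNgt ltn_ord.
Qed.

(** Abel summation, by descending induction on [k]: replacing [u k] by the larger [u k.+1] in front
    of the tail beyond [k] is harmless because that tail is nonnegative. This is how the condition
    on the tail sums of [alpha] acts on coordinates that increase with the index. *)
Lemma tailn_sum_le alpha u :
  (forall k : nat, 0 <= tailn alpha k) -> {homo u : i j / (i <= j)%N >-> i <= j} ->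
  forall k, u k * tailn alpha k <= \sum_(l < n | (k <= l)%N) alpha l * u l.
Proof.
move=> ta uh k; rewrite /tailn.
have [e] := ubnP (n - k); elim: e k => // e IH k nk.
have [nk'|kn] := leqP n k.
  by rewrite !sum_ord_ge_oversize// mulr0.
pose k0 := Ordinal kn.
rewrite !(sum_ord_geS _ k0)/= mulrDr [u _ * _]mulrC lerD2l.
apply: le_trans (IH k.+1 _); last by rewrite subnS prednK ?subn_gt0.
by apply: ler_wpM2r => //; [exact: ta | by apply: uh].
Qed.

Lemma tailn_sum_ge0 alpha u :
  (forall k : nat, 0 <= tailn alpha k) -> (forall i, 0 <= u i) ->
  {homo u : i j / (i <= j)%N >-> i <= j} ->
  forall k, 0 <= \sum_(l < n | (k <= l)%N) alpha l * u l.
Proof.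
by move=> ta u0 uh k; apply: le_trans (tailn_sum_le _ _ ta uh k); rewrite mulr_ge0.
Qed.

Lemma sum_partial_tailn alpha F :
  \sum_i alpha i * (\sum_(l < n | (l <= i)%N) F l) =
  \sum_(l < n) tailn alpha l * F l.
Proof.
under eq_bigr do rewrite mulr_sumr.
rewrite (exchange_big_dep xpredT)//=; apply: eq_bigr => l _.
by rewrite /tailn mulr_suml.
Qed.

End TailSums.

(** * Elementary exponential estimates *)

Section ExpBounds.
Context {R : realType}.
Implicit Types a b d y : R.

Lemma expR_sub1_le a : expR a - 1 <= a * expR a.
Proof.
rewrite -subr_ge0 (_ : _ - _ = expR a * (expR (- a) - (1 + - a))); last first.
  by rewrite !mulrDr -expRD subrr expR0; ring.
by rewrite mulr_ge0 ?expR_ge0// subr_ge0 expR_ge1Dx.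
Qed.

(** The two inequalities [1 + a <= expR a] and [expR a - 1 <= a * expR a] place the remainder
    between 0 and [a * (expR a - 1)]; the second factor is then bounded once more by one of them,
    according to the sign of [a]. *)
Lemma expR_taylor2 a : `|expR a - 1 - a| <= a ^+ 2 * expR `|a|.
Proof.
have h0 := expR_ge1Dx a; have h1 := expR_sub1_le a.
rewrite ger0_norm; last by lra.
have [a0|a0] := leP 0 a.
  apply: le_trans (_ : a * (a * expR a) <= _); last by rewrite mulrA expr2 ger0_norm.
  apply: le_trans (_ : a * (expR a - 1) <= _); first by lra.
  exact: ler_wpM2l.
have e1 : 1 <= expR (- a) by rewrite -expR0 ler_expR; lra.
apply: le_trans (_ : a ^+ 2 * 1 <= _); last first.
  by rewrite ler_wpM2l ?sqr_ge0// -expR0 ler_expR.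
apply: le_trans (_ : a * (expR a - 1) <= _); first by lra.
rewrite mulr1 expr2; apply: ler_wnM2l; [exact: ltW|lra].
Qed.

Lemma expRN_lipschitz a b : 0 <= a -> 0 <= b ->
  `|expR (- a) - expR (- b)| <= `|a - b|.
Proof.
wlog ab : a b / a <= b => [H a0 b0|a0 b0].
  have [ab|/ltW ba] := leP a b; first exact: H.
  by rewrite distrC (distrC a) H.
rewrite ger0_norm; last by rewrite subr_ge0 ler_expR lerN2.
rewrite ler0_norm ?subr_le0// opprB.
have e1 : expR (- b) = expR (- a) * expR (a - b) by rewrite -expRD; congr expR; ring.
have h := expR_ge1Dx (a - b); have ea : expR (- a) <= 1 by rewrite -expR0 ler_expR; lra.
have ea0 : 0 <= expR (- a) by exact: expR_ge0.
rewrite e1; apply: le_trans (_ : expR (- a) * (b - a) <= _); last first.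
  by rewrite -[leRHS]mul1r; apply: ler_wpM2r; [lra|].
rewrite -[X in X - _]mulr1 -mulrBr; apply: ler_wpM2l => //; lra.
Qed.

(** Either [expR (c * y)] is at most [K] or it is at most its square over [K]. Since [y] exceeds
    [eta], it is comparable with [expR (c * y) - 1], and the square of the latter has a mean of
    order [delta] over a cell, which the square of the exponential itself has not. *)
Lemma exp_tail_split (c eta K y : R) : 0 < c -> 0 < eta -> 0 < K -> eta < y ->
  expR (c * y) <= K + (1 - expR (- c * eta)) ^- 2 / K * (expR (c * y) - 1) ^+ 2.
Proof.
move=> c0 eta0 K0 ey.
set Q := _ ^- 2; set e := expR (c * y).
have q0 : 0 < 1 - expR (- c * eta).
  by rewrite subr_gt0 -expR0 ltr_expR mulNr oppr_lt0 mulr_gt0.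
have e0 : 0 < e by exact: expR_gt0.
have h : e ^+ 2 <= Q * (e - 1) ^+ 2.
  rewrite mulrC ler_pdivlMr ?exprn_gt0// -exprMn ler_sqr ?nnegrE; last 2 first.
  - by rewrite mulr_ge0 ?ltW.
  - rewrite subr_ge0 -expR0 ler_expR; apply: mulr_ge0; lra.
  rewrite mulrBr mulr1 lerD2l lerN2 /e -expRD -expR0 ler_expR.
  by rewrite mulNr -mulrBr mulr_ge0//; lra.
have [eK|Ke] := leP e K.
  by rewrite ler_wpDr// mulr_ge0 ?sqr_ge0// divr_ge0 ?invr_ge0 ?sqr_ge0// ltW.
apply: le_trans (_ : K + e ^+ 2 / K <= _); last first.
  by rewrite lerD2l [leRHS]mulrAC ler_wpM2r ?invr_ge0 ?(ltW K0).
apply: ler_wpDl; first exact: ltW.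
by rewrite ler_pdivlMr// expr2; apply: ler_wpM2l; exact: ltW.
Qed.

(** Here [d] will be a push and [y] the drop of the first coordinate that bounds it. A push up to
    [eta] costs [eta] times itself, and total pushing is bounded per unit time; a larger one costs
    an indicator of probability o(delta), with weight of order [K], plus a term of mean O(delta)
    with a factor [1 / K]. *)
Lemma sqr_expR_split (A eta K d y : R) : 0 <= A -> 0 < eta -> 0 < K ->
  0 <= d -> d <= y ->
  d ^+ 2 * expR (A * d) <= eta * expR (A * eta) * d +
    (2 * K * (eta < y)%R%:R +
    2 * ((1 - expR (- (A + 1) * eta)) ^- 2 / K) * (expR ((A + 1) * y) - 1) ^+ 2).
Proof.
move=> A0 eta0 K0 d0 dy.
have Q0 : 0 <= (1 - expR (- (A + 1) * eta)) ^- 2 / K.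
  by rewrite divr_ge0 ?invr_ge0 ?sqr_ge0// ltW.
have [de|ed] := leP d eta.
  rewrite -[leLHS]addr0 lerD//.
    rewrite expr2 mulrAC; apply: ler_wpM2r => //.
    by apply: ler_pM => //; rewrite ?expR_ge0// ler_expR ler_wpM2l.
  by rewrite addr_ge0// mulr_ge0// ?sqr_ge0// mulr_ge0// ltW.
apply: ler_wpDl; first by rewrite !mulr_ge0 ?expR_ge0// ltW.
have -> : eta < y by exact: lt_le_trans dy.
rewrite mulr1 -[2 * (_ / K) * _]mulrA -mulrDr.
have y0 : 0 <= y by exact: le_trans dy.
apply: le_trans (_ : y ^+ 2 * expR (A * y) <= _).
  by apply: ler_pM; rewrite ?sqr_ge0 ?expR_ge0 ?ler_expR ?ler_wpM2l// ler_sqr.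
(* The square is absorbed by [y ^+ 2 <= 2 * expR y]; this is where the exponent [A + 1] comes
   from. *)
apply: le_trans (_ : 2 * expR ((A + 1) * y) <= _); last first.
  apply: ler_wpM2l => //; apply: exp_tail_split => //; first by lra.
  exact: lt_le_trans dy.
rewrite (_ : (A + 1) * y = y + A * y); last by rewrite mulrDl mul1r addrC.
rewrite expRD mulrA; apply: ler_wpM2r; first exact: expR_ge0.
have := expR_ge1Dxn 1 y0; rewrite (_ : 2`!%:R = 2)//; lra.
Qed.

End ExpBounds.

Section Lindley.
Context {R : realType} {n : nat} (x : 'I_n -> nat -> R).

Definition step_sum (i j : nat) : R := \sum_(l < n | (l <= i)%N) x l j.

Fixpoint lindley (i j : nat) : R :=
  if j is j'.+1 then Num.max 0 (lindley i j' + step_sum i j') else 0.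

(** Increment over cell [j] of the regulator in the discrete Skorokhod reflection. *)
Definition pushing (i j : nat) : R := Num.max 0 (- (lindley i j + step_sum i j)).

Lemma lindley_ge0 i j : 0 <= lindley i j.
Proof. by case: j => [|j] //=; rewrite le_max lexx. Qed.

Lemma pushing_ge0 i j : 0 <= pushing i j.
Proof. by rewrite le_max lexx. Qed.

Lemma lindleyS i j : lindley i j.+1 = lindley i j + step_sum i j + pushing i j.
Proof.
rewrite /= /pushing; set a := _ + _.
by have [a0|a0] := leP 0 a; [rewrite max_l|rewrite max_r]; lra.
Qed.

Lemma lindley_pushing i j : pushing i j != 0 -> lindley i j.+1 = 0.
Proof.
rewrite /= /pushing; set a := _ + _.
have [a0|a0] := leP 0 a; first by rewrite max_l ?eqxx//; lra.
by [].
Qed.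

(** The unrolled recursion is the walk minus its running minimum. Stating this as a bound together
    with an index that attains it allows a direct comparison with the infimum of a path in
    continuous time. *)
Lemma lindley_supremum (s : nat -> R) i j : s 0%N = 0 ->
  (forall j, s j.+1 = s j + step_sum i j) ->
  (forall l, (l <= j)%N -> s j - s l <= lindley i j) /\
  (exists2 l, (l <= j)%N & lindley i j = s j - s l).
Proof.
move=> s0 sS; elim: j => [|j [IH1 [l lj IH2]]].
  split; last by exists 0%N => //=; rewrite subrr.
  by move=> l; rewrite leqn0 => /eqP ->; rewrite subrr.
split => [l'|].
  rewrite leq_eqVlt => /orP[/eqP->|]; first by rewrite subrr lindley_ge0.
  rewrite ltnS => /IH1 h /=; rewrite le_max sS; apply/orP; right.
  by rewrite -subr_ge0 in h *; lra.
rewrite /=; have [h|h] := leP 0 (lindley i j + step_sum i j).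
  by exists l; rewrite ?leqW// IH2 sS; ring.
by exists j.+1 => //; rewrite subrr.
Qed.

Hypothesis x_ge0 : forall (i : 'I_n) j, (0 < i)%N -> 0 <= x i j.

Lemma step_sum_homo j : {homo step_sum^~ j : i i' / (i <= i')%N >-> i <= i'}.
Proof.
move=> i i' ii'; rewrite /step_sum (bigID (fun l : 'I_n => (l <= i)%N) (fun l => (l <= i')%N))/=.
rewrite -[leLHS]addr0; apply: lerD; last first.
  by apply: sumr_ge0 => l /andP[_]; rewrite -ltnNge => il; apply: x_ge0; exact: leq_ltn_trans il.
rewrite le_eqVlt; apply/orP; left; apply/eqP; apply: eq_bigl => l.
by apply/idP/andP => [li|[]//]; rewrite (leq_trans li).
Qed.

Lemma lindley_homo j : {homo lindley^~ j : i i' / (i <= i')%N >-> i <= i'}.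
Proof.
elim: j => [|j IH] i i' ii' //=.
have h := lerD (IH _ _ ii') (step_sum_homo j _ _ ii').
by rewrite ge_max le_max lexx/= le_max h orbT.
Qed.

Lemma pushing_homo i i' j : (i <= i')%N -> pushing i' j <= pushing i j.
Proof.
move=> ii'; have h := lerD (lindley_homo j _ _ ii') (step_sum_homo j _ _ ii').
by rewrite /pushing ge_max le_max lexx/= le_max lerN2 h orbT.
Qed.

(** Coordinate 0 is pushed most, and it starts the cell at a nonnegative level. All error terms are
    thereby controlled by the first coordinate of the process alone. *)
Lemma pushing_le i j : pushing i j <= Num.max 0 (- step_sum 0 j).
Proof.
apply: le_trans (pushing_homo _ _ _ (leq0n i)) _.
rewrite /pushing ge_max le_max lexx/= le_max; apply/orP; right.
by have := lindley_ge0 0 j; lra.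
Qed.

Context (alpha : 'I_n -> R).
Hypothesis ta : forall k : nat, 0 <= tailn alpha k.

Definition lindley_exp (j : nat) : R := expR (- \sum_i alpha i * lindley i j).

Definition pushing_exp (i j : nat) : R :=
  expR (- \sum_(l < n | (i < l)%N) alpha l * lindley l j.+1) * pushing i j.

Lemma lindley_exp_ge0 j : 0 <= lindley_exp j.
Proof. exact: expR_ge0. Qed.

Lemma lindley_exp_le1 j : lindley_exp j <= 1.
Proof.
rewrite /lindley_exp -[leRHS]expR0 ler_expR oppr_le0.
have := tailn_sum_ge0 _ (lindley^~ j) ta (lindley_ge0^~ j) (lindley_homo j) 0.
by rewrite (eq_bigl xpredT).
Qed.

Lemma pushing_exp_ge0 i j : 0 <= pushing_exp i j.
Proof. by rewrite mulr_ge0 ?expR_ge0 ?pushing_ge0. Qed.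

Lemma pushing_exp_le i j : pushing_exp i j <= pushing i j.
Proof.
rewrite -[leRHS]mul1r ler_wpM2r ?pushing_ge0// -[leRHS]expR0 ler_expR oppr_le0.
exact: (tailn_sum_ge0 _ (lindley^~ j.+1) ta (lindley_ge0^~ _) (lindley_homo _) i.+1).
Qed.

(* Over one step the linear form moves by the increment plus the pushing;
   Abel summation turns the coefficients of the increment into tail sums. *)
Lemma lindley_exp_step j : lindley_exp j.+1 - lindley_exp j =
  lindley_exp j * (expR (- \sum_(i < n) tailn alpha i * x i j) - 1)
  - lindley_exp j.+1 * (expR (\sum_i alpha i * pushing i j) - 1).
Proof.
suff : lindley_exp j.+1 * expR (\sum_i alpha i * pushing i j) =
    lindley_exp j * expR (- \sum_(i < n) tailn alpha i * x i j) by lra.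
rewrite /lindley_exp -!expRD -sum_partial_tailn; congr expR.
rewrite -!sumrN -!big_split/=; apply: eq_bigr => i _.
have := lindleyS i j; rewrite /= => ->; rewrite /step_sum; ring.
Qed.

(* Coordinate i is pushed only when coordinates 0, ..., i all end the step at 0,
   so that only the coordinates above i remain in the exponential. *)
Lemma pushing_expE j :
  lindley_exp j.+1 * (\sum_i alpha i * pushing i j) =
  \sum_i alpha i * pushing_exp i j.
Proof.
rewrite mulr_sumr; apply: eq_bigr => i _; rewrite mulrCA; congr (_ * _).
rewrite /pushing_exp; have [->|pn0] := eqVneq (pushing i j) 0.
  by rewrite !mulr0.
congr (expR (- _) * _).
rewrite (bigID (fun l : 'I_n => (i < l)%N))/= addrC big1 ?add0r// => l.
rewrite -leqNgt => li; rewrite (_ : Num.max _ _ = 0) ?mulr0//.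
rewrite -[Num.max _ _]/(lindley l j.+1).
apply/eqP; rewrite eq_le lindley_ge0 andbT.
by rewrite -(lindley_pushing _ _ pn0); exact: lindley_homo.
Qed.

(** The exponent [\sum_i alpha i * pushing i j] is at most [A * pushing 0 j] in absolute value, so
    the second-order remainder is a square of the kind treated by [sqr_expR_split], with [y] the
    drop of the first coordinate. The parameters [eta] and [K] stay free, to be tuned once the mesh
    is in play. *)
Lemma pushing_error (eta K : R) j : 0 < eta -> 0 < K ->
  let A := \sum_(i < n) `|alpha i| in let c := A + 1 in
  `| lindley_exp j.+1 * (expR (\sum_i alpha i * pushing i j) - 1)
     - \sum_i alpha i * pushing_exp i j | <=
  A ^+ 2 * (eta * expR (A * eta) * pushing 0 j +
    (2 * K * (step_sum 0 j < - eta)%R%:R +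
     2 * ((1 - expR (- c * eta)) ^- 2 / K) * (expR (- (c * step_sum 0 j)) - 1) ^+ 2)).
Proof.
move=> eta0 K0; set A := \sum_i _; set c := A + 1.
rewrite -pushing_expE; set a := \sum_i _.
have A0 : 0 <= A by rewrite /A sumr_ge0.
have aA : `|a| <= A * pushing 0 j.
  rewrite /a (le_trans (ler_norm_sum _ _ _))// mulr_suml ler_sum// => i _.
  by rewrite normrM ler_wpM2l// ger0_norm ?pushing_ge0// pushing_homo.
rewrite -mulrBr normrM ger0_norm ?lindley_exp_ge0//.
apply: le_trans (_ : `|expR a - 1 - a| <= _).
  by rewrite -[leRHS]mul1r ler_wpM2r ?lindley_exp_le1.
apply: le_trans (expR_taylor2 a) _.
apply: le_trans (_ : A ^+ 2 * (pushing 0 j ^+ 2 * expR (A * pushing 0 j)) <= _).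
  rewrite mulrA -exprMn ler_pM ?sqr_ge0 ?expR_ge0 ?ler_expR//.
  by rewrite -(real_normK (num_real a)) ler_sqr ?nnegrE// mulr_ge0 ?pushing_ge0.
apply: ler_wpM2l; first exact: sqr_ge0.
have pl := pushing_le 0 j; have p0 := pushing_ge0 0 j.
apply: le_trans (sqr_expR_split _ _ _ _ _ A0 eta0 K0 p0 pl) _.
set y := Num.max _ _.
have Q0 : 0 <= (1 - expR (- (A + 1) * eta)) ^- 2 / K.
  by rewrite divr_ge0 ?invr_ge0 ?sqr_ge0// ltW.
rewrite lerD2l lerD//.
  apply: ler_wpM2l; first by rewrite mulr_ge0// ltW.
  by rewrite ler_nat /y lt_max [eta < 0]ltNge (ltW eta0)/= ltrNr.
apply: ler_wpM2l; first by rewrite mulr_ge0.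
rewrite /y; have [h|h] := leP 0 (- step_sum 0 j); first by rewrite mulrN.
by rewrite mulr0 expR0 subrr expr0n/= sqr_ge0.
Qed.

End Lindley.

(** * Cadlag paths without negative jumps *)

Section CadlagPaths.
Context {R : realType}.
Implicit Types (f : R -> R) (T eta delta : R).

(** A one-sided modulus of continuity: rises are unrestricted, so cadlag paths without negative
    jumps still have it. *)
Definition downward_modulus f T delta eta :=
  forall u v, 0 <= u -> u <= v -> v <= T -> v - u <= delta -> f u - eta <= f v.

(** Compactness of the interval glues local bounds to the right and to the left of each point. The
    bound makes [inf] over an initial segment a genuine infimum. *)
Lemma cadlag_bounded f T : cadlag f ->
  exists M, forall u, 0 <= u -> u <= T -> `|f u| <= M.
Proof.
move=> [fr fl].
have /compact_near_coveringP cK : compact `[0, T] by exact: segment_compact.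
have /cK : forall x, `[0, T]%classic x ->
    \forall x' \near x & M \near +oo, x' \in `[0, T]%R -> `|f x'| <= M.
  move=> x /=; rewrite in_itv/= => /andP[x0 xT].
  have [Mr [rr rr0 Hr]] : exists M, exists2 r, 0 < r & forall y, x <= y < x + r -> `|f y| <= M.
    have /cvgrPdist_lt /(_ 1 ltr01) := fr x x0.
    rewrite near_withinE => -[r /= r0 h].
    exists (`|f x| + 1), r => // y /andP[xy yr].
    move: xy; rewrite le_eqVlt => /orP[/eqP<-|xy]; first by rewrite lerDl.
    have := h y; rewrite /= ltr0_norm ?subr_lt0// opprB ltrBlDl => /(_ yr xy) h'.
    rewrite -(subrK (f x) (f y)) addrC (le_trans (ler_normD _ _))// lerD2l.
    by rewrite distrC ltW.
  have [Ml [rl rl0 Hl]] : exists M, exists2 r, 0 < r &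
      forall y, 0 <= y -> x - r < y < x -> `|f y| <= M.
    move: x0; rewrite le_eqVlt => /orP[/eqP<-|x0].
      by exists 0, 1 => // y y0 /andP[_]; rewrite ltNge y0.
    have /cvg_ex[/= l] := fl x x0.
    move=> /cvgrPdist_lt /(_ 1 ltr01).
    rewrite near_withinE => -[r /= r0 h].
    exists (`|l| + 1), r => // y y0 /andP[ry yx].
    have := h y; rewrite /= gtr0_norm ?subr_gt0// ltrBlDl -ltrBlDr => /(_ ry yx) h'.
    rewrite -(subrK l (f y)) addrC (le_trans (ler_normD _ _))// lerD2l.
    by rewrite distrC ltW.
  exists (ball x (Num.min rr rl), [set M | Num.max Mr Ml < M]).
    split; last by exists (Num.max Mr Ml); split => //; exact: num_real.
    by apply: nbhsx_ballx; rewrite lt_min rr0.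
  case=> y M /= []; rewrite /ball/= lt_min => /andP[yr yl].
  rewrite gt_max => /andP[Mr' Ml'].
  rewrite in_itv/= => /andP[y0 yT].
  have [xy|yx] := leP x y.
    apply: le_trans (ltW Mr'); apply: Hr; rewrite xy/= -ltrBlDl.
    by apply: le_lt_trans yr; rewrite distrC ler_norm.
  apply: le_trans (ltW Ml'); apply: Hl => //; rewrite yx andbT ltrBlDl -ltrBlDr.
  by apply: le_lt_trans yl; rewrite ler_norm.
move=> [M [_ H]]; exists (M + 1) => u u0 uT.
have := H (M + 1); rewrite ltrDl ltr01 => /(_ isT u); apply.
  by rewrite /= in_itv/= u0.
by rewrite in_itv/= u0.
Qed.

(** Near [x], values on the right are close to [f x] and values on the left to the left limit [l].
    For two points on opposite sides of [x] the drop is small because [l <= f x]; on the same side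
    both values are close to the same number. Compactness makes this uniform. *)
Lemma cadlag_downward_modulus f T eta : cadlag f -> no_negative_jumps f ->
  0 < eta -> exists2 d0, 0 < d0 & downward_modulus f T d0 eta.
Proof.
move=> [fr fl] fj eta0.
have /compact_near_coveringP cK : compact `[0, T] by exact: segment_compact.
have /cK : forall x, `[0, T]%classic x -> \forall x' \near x & e \near 0^'+,
    forall v, 0 <= x' -> x' <= v -> v - x' <= e -> f x' - eta <= f v.
  move=> x /=; rewrite in_itv/= => /andP[x0 xT].
  have e20 : 0 < eta / 2 by rewrite divr_gt0.
  have [rr rr0 Hr] : exists2 r, 0 < r & forall y, x <= y < x + r -> `|f x - f y| <= eta / 2.
    have /cvgrPdist_lt /(_ _ e20) := fr x x0.
    rewrite near_withinE => -[r /= r0 h].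
    exists r => // y /andP[xy yr].
    move: xy; rewrite le_eqVlt => /orP[/eqP<-|xy]; first by rewrite subrr normr0 ltW.
    have := h y; rewrite /= ltr0_norm ?subr_lt0// opprB ltrBlDl => /(_ yr xy) h'.
    exact: ltW.
  have [rl rl0 Hl] : exists2 r, 0 < r & exists2 l, (0 < x -> l <= f x) &
      forall y, 0 <= y -> x - r < y < x -> `|l - f y| <= eta / 2.
    move: x0; rewrite le_eqVlt => /orP[/eqP<-|x0].
      (* At [x = 0] there is nothing on the left, so any value does for [l]. *)
      exists 1 => //; exists 0; first by rewrite ltxx.
      by move=> y y0 /andP[_]; rewrite ltNge y0.
    have := fl x x0; have := fj x x0; set l := lim _ => lf fc.
    have /cvgrPdist_lt /(_ _ e20) : f x0 @[x0 --> x^'-] --> l by exact: fc.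
    rewrite near_withinE => -[r /= r0 h].
    exists r => //; exists l => // y y0 /andP[ry yx].
    have := h y; rewrite /= gtr0_norm ?subr_gt0// ltrBlDl -ltrBlDr => /(_ ry yx) h'.
    exact: ltW.
  case: Hl => l lf Hl.
  (* Half the radius for the first point and half for the step keep the second point within the full
     radius. *)
  exists (ball x (Num.min rr rl / 2), [set e : R | 0 < e < Num.min rr rl / 2]).
    have r0 : 0 < Num.min rr rl / 2 by rewrite divr_gt0// lt_min rr0.
    split; first by apply: nbhsx_ballx.
    near=> e; apply/andP; split; near: e; first exact: nbhs_right_gt.
    exact: nbhs_right_lt.
  case=> y e /= []; rewrite /ball/= => yr /andP[e0 er] v y0 yv ve.
  have mr : Num.min rr rl <= rr by rewrite ge_min lexx.
  have ml : Num.min rr rl <= rl by rewrite ge_min lexx orbT.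
  move: yr; rewrite ltr_norml => /andP[yr1 yr2].
  have yl : y < x -> `|l - f y| <= eta / 2 by move=> yx; apply: Hl => //; lra.
  have vl : v < x -> `|l - f v| <= eta / 2 by move=> yx; apply: Hl; lra.
  have yR : x <= y -> `|f x - f y| <= eta / 2 by move=> yx; apply: Hr; lra.
  have vR : x <= v -> `|f x - f v| <= eta / 2 by move=> yx; apply: Hr; lra.
  have [xy|yx] := leP x y.
    move: (yR xy) (vR (le_trans xy yv)); rewrite !ler_norml; lra.
  have [xv|vx] := leP x v.
    have lx : l <= f x by apply: lf; exact: le_lt_trans yx.
    by move: (yl yx) (vR xv); rewrite !ler_norml; lra.
  by move: (yl yx) (vl vx); rewrite !ler_norml; lra.
move=> [r /= r0 H]; exists (r / 2); first by rewrite divr_gt0.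
move=> u v u0 uv vT vu; apply: (H (r / 2) _ _ u _ v) => //.
- by rewrite /ball/= sub0r normrN gtr0_norm ?divr_gt0//; lra.
- by rewrite divr_gt0.
- by rewrite /= in_itv/= u0/=; lra.
Unshelve. all: by end_near. Qed.

Lemma downward_modulus_le f g T delta eta :
  (forall u v, 0 <= u -> u <= v -> f v - f u <= g v - g u) ->
  downward_modulus f T delta eta -> downward_modulus g T delta eta.
Proof.
by move=> fg h u v u0 uv vT vu; have := fg _ _ u0 uv; have := h u v u0 uv vT vu; lra.
Qed.

Lemma cadlagD f g : cadlag f -> cadlag g -> cadlag (fun t => f t + g t).
Proof.
move=> [fr fl] [gr gl]; split => t t0.
  by apply: cvgD; [exact: fr|exact: gr].
by apply: is_cvgD; [exact: fl|exact: gl].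
Qed.

Lemma cadlag0 : cadlag (fun _ : R => 0 : R).
Proof. by split => t _; [exact: cvg_cst|exact: is_cvg_cst]. Qed.

Lemma cadlag_sum I (r : seq I) (Q : pred I) (F : I -> R -> R) :
  (forall i, cadlag (F i)) -> cadlag (fun t => \sum_(i <- r | Q i) F i t).
Proof.
move=> FC; elim: r => [|i r IH].
  by under [fun t => _]funext => t do rewrite big_nil; exact: cadlag0.
under [fun t => _]funext => t do rewrite big_cons.
by case: (Q i) => //; exact: cadlagD.
Qed.

End CadlagPaths.

(** * Reflection of a path at its running infimum *)

Section Reflection.
Context {R : realType}.
Implicit Types (f : R -> R) (t delta eta : R).

Definition running_inf f t := inf [set f s | s in `[0, t]].

Lemma running_inf_lb f t s : cadlag f -> 0 <= s -> s <= t -> running_inf f t <= f s.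
Proof.
move=> fc s0 st; apply: ge_inf; last by exists s => //=; rewrite in_itv/= s0.
have [M HM] := cadlag_bounded f t fc; exists (- M) => _ [u /= + <-].
rewrite in_itv/= => /andP[u0 ut]; have := HM u u0 ut; rewrite ler_norml; lra.
Qed.

Lemma running_inf_ge f t a : 0 <= t -> (forall s, 0 <= s -> s <= t -> a <= f s) ->
  a <= running_inf f t.
Proof.
move=> t0 h; apply: lb_le_inf.
  by exists (f 0), 0 => //=; rewrite in_itv/= lexx.
by move=> _ [u /= + <-]; rewrite in_itv/= => /andP[u0 ut]; exact: h.
Qed.

(* The Lindley recursion driven by the increments of [f] on a grid
   underestimates the reflection of [f] by at most the drop of [f] within one
   grid step. *)
Lemma lindley_reflection n (x : 'I_n -> nat -> R) i f delta (N : nat) :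
  cadlag f -> 0 < delta -> f 0 = 0 ->
  (forall j, f (j.+1%:R * delta) = f (j%:R * delta) + step_sum x i j) ->
  forall j, lindley x i j <= f (j%:R * delta) - running_inf f (j%:R * delta) /\
  (forall eta, downward_modulus f (N%:R * delta) delta eta -> (j <= N)%N ->
   f (j%:R * delta) - running_inf f (j%:R * delta) <= lindley x i j + eta).
Proof.
move=> fc d0 f0 fS j.
have s0 : f (0%:R * delta) = 0 by rewrite mul0r.
have [h1 [l lj h2]] := lindley_supremum x (fun j => f (j%:R * delta)) i j s0 fS.
split.
  rewrite h2 lerD2l lerN2; apply: running_inf_lb => //.
    by rewrite mulr_ge0// ltW.
  by rewrite ler_pM2r// ler_nat.
move=> eta mf jN; rewrite lerBlDr -lerBlDl.
apply: running_inf_ge; first by rewrite mulr_ge0// ltW.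
(* [k%:R * delta] is the last grid point at or before [s]; from there to [s] the path falls by at
   most [eta], which is all that the minimum over the grid can miss. *)
move=> s sp sj; set k := Num.truncn (s / delta).
have /andP[k1 k2] : k%:R <= s / delta < k.+1%:R.
  by apply: truncn_itv; rewrite divr_ge0// ltW.
rewrite ler_pdivlMr// in k1; rewrite ltr_pdivrMr// in k2.
have kj : (k <= j)%N by rewrite -(ler_nat R) -(ler_pM2r d0) (le_trans k1).
have := h1 k kj; suff : f (k%:R * delta) - eta <= f s by lra.
apply: mf => //; first by rewrite mulr_ge0// ltW.
  by apply: le_trans sj _; rewrite ler_pM2r// ler_nat.
by rewrite -natr1 mulrDl mul1r in k2; lra.
Qed.

End Reflection.

(** * Expectations and independence *)

Section Expectation.
Context {d} {T : measurableType d} {R : realType} (P : probability T R).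
Implicit Types (f g U V : T -> R).

Lemma le_Rintegrable f g : measurable_fun setT f -> (forall w, `|f w| <= g w) ->
  P.-integrable setT (EFin \o g) -> P.-integrable setT (EFin \o f).
Proof.
move=> mf fg; apply: le_integrable => //; first exact/measurable_EFinP.
by move=> w _ /=; rewrite lee_fin (le_trans (fg w))// ler_norm.
Qed.

Lemma cst_integrable (r : R) : P.-integrable setT (EFin \o (fun _ => r)).
Proof. exact: finite_measure_integrable_cst. Qed.

Lemma bounded_Rintegrable f M : measurable_fun setT f -> (forall w, `|f w| <= M) ->
  P.-integrable setT (EFin \o f).
Proof. by move=> mf fM; apply: le_Rintegrable mf fM _; exact: cst_integrable. Qed.

Lemma ge0_integrable_fin f r : measurable_fun setT f -> (forall w, 0 <= f w) ->
  (\int[P]_w (f w)%:E = r%:E)%E -> P.-integrable setT (EFin \o f).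
Proof.
move=> mf f0 fr; apply/integrableP; split; first exact/measurable_EFinP.
under eq_integral => w _ do rewrite /= ger0_norm//.
by rewrite fr ltry.
Qed.

Lemma EFin_Rintegral f : P.-integrable setT (EFin \o f) ->
  (\int[P]_w (f w)%:E = (\int[P]_w f w)%:E)%E.
Proof. by move=> intf; rewrite fineK//; exact: integrable_fin_num. Qed.

Lemma Rintegral_prob_cst (r : R) : \int[P]_w r = r.
Proof. by rewrite Rintegral_cst// [X in fine X]probability_setT/= mulr1. Qed.

Lemma Rintegral_le1 f : measurable_fun setT f -> (forall w, 0 <= f w) ->
  (forall w, f w <= 1) -> 0 <= \int[P]_w f w <= 1.
Proof.
move=> mf f0 f1; rewrite Rintegral_ge0//= -[leRHS]Rintegral_prob_cst le_Rintegral//.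
  by apply: (bounded_Rintegrable _ 1) => // w; rewrite ger0_norm.
exact: cst_integrable.
Qed.

Lemma Rintegral_sum (I : Type) (s : seq I) (F : I -> T -> R) :
  (forall i, P.-integrable setT (EFin \o F i)) ->
  P.-integrable setT (EFin \o (fun w => \sum_(i <- s) F i w)) /\
  \int[P]_w (\sum_(i <- s) F i w) = \sum_(i <- s) \int[P]_w F i w.
Proof.
move=> iF; elim: s => [|i s [IH1 IH2]].
  under [fun w => _]funext => w do rewrite big_nil; rewrite big_nil.
  by split; [exact: cst_integrable|exact: Rintegral_prob_cst].
under [fun w => _]funext => w do rewrite big_cons; rewrite big_cons; split.
  exact: (integrableD _ (iF i) IH1).
by rewrite RintegralD// IH2.
Qed.

Lemma Rintegral_dominated (f_ : nat -> T -> R) f g :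
  (forall k, measurable_fun setT (f_ k)) ->
  (forall w, f_ k w @[k --> \oo] --> f w) ->
  P.-integrable setT (EFin \o g) -> (forall k w, `|f_ k w| <= g w) ->
  \int[P]_w f_ k w @[k --> \oo] --> \int[P]_w f w.
Proof.
move=> mf ff ig fg.
have mf' : measurable_fun setT f by apply: measurable_fun_cvg mf _ => w _; exact: ff.
have intf : P.-integrable setT (EFin \o f).
  apply: le_Rintegrable mf' _ ig => w.
  have := ff w => /cvg_norm h; apply: (ler_cvg_to h (cvg_cst _)).
  by apply: nearW => k; exact: fg.
apply: fine_cvg; rewrite -EFin_Rintegral//.
have [//| | | | | ] := @dominated_convergence _ T R P setT measurableT
  (fun k => EFin \o f_ k) (EFin \o f) (EFin \o g); last by [].
- by move=> k; exact/measurable_EFinP.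
- exact/measurable_EFinP.
- by apply: aeW => w _; apply: cvg_EFin; [exact: nearW|exact: ff].
- exact: ig.
- by apply: aeW => w k _; rewrite lee_fin.
Qed.

Lemma Rintegral_gt0_ae f : measurable_fun setT f -> (forall w, 0 <= f w) ->
  \int[P]_w f w = 0 -> P.-integrable setT (EFin \o f) ->
  {ae P, forall w, f w = 0}.
Proof.
move=> mf f0 E0 intf.
have : (\int[P]_w `|(f w)%:E| = 0)%E.
  under eq_integral => w _ do rewrite /= ger0_norm//.
  by rewrite EFin_Rintegral// E0.
have mEf : measurable_fun setT (EFin \o f) by exact/measurable_EFinP.
move/(ae_eq_integral_abs _ measurableT mEf).
by move=> H; apply: filterS H => w /= /(_ I) [].
Qed.

End Expectation.

Section Independence.
Context {d} {T : measurableType d} {R : realType} (P : probability T R).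
Implicit Types (G : set (set T)) (A B : set T) (U V : T -> R).

(** For fixed [B], both sides are finite measures in [A], the restriction of [P] to [B] and a
    multiple of [P]; they agree on a pi-system and so on what it generates. *)
Lemma sigma_algebra_indep G B : G `<=` measurable -> setI_closed G -> G setT ->
  measurable B -> (forall A, G A -> P (A `&` B) = (P A * P B)%E) ->
  forall A, <<s G >> A -> P (A `&` B) = (P A * P B)%E.
Proof.
move=> Gm GI GT mB GB A sA.
have B0 : 0 <= fine (P B) by rewrite fine_ge0.
have Bf : (fine (P B))%:E = P B by rewrite fineK// fin_num_measure.
pose r := NngNum B0.
have := @g_sigma_algebra_measure_unique _ R T G Gm (fun _ => setT) (fun _ => GT)
  _ (mrestr P mB) (mscale r P) GI _ _ A sA.
rewrite /mscale/= /mrestr /= => H; rewrite muleC -[in RHS]Bf; apply: H.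
- by rewrite bigcup_const//; exists 0%N.
- by move=> A' GA'; rewrite GB// /mscale/= Bf muleC.
- by move=> k; rewrite setTI; exact: le_lt_trans (probability_le1 _ _) (ltry _).
Qed.

(** The law of the pair is the product of the laws, and Tonelli's theorem factors the integral.
    Nonnegativity allows infinite values, so integrability need not be known beforehand. *)
Lemma indep_integralM U V : measurable_fun setT U -> measurable_fun setT V ->
  (forall w, 0 <= U w) -> (forall w, 0 <= V w) ->
  (forall A B : set R, measurable A -> measurable B ->
     P ((U @^-1` A) `&` (V @^-1` B)) = (P (U @^-1` A) * P (V @^-1` B))%E) ->
  (\int[P]_w (U w * V w)%:E = \int[P]_w (U w)%:E * \int[P]_w (V w)%:E)%E.
Proof.
move=> mU mV U0 V0 UV.
pose U' : {mfun T >-> R} := HB.pack U (isMeasurableFun.Build _ _ _ _ _ mU).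
pose V' : {mfun T >-> R} := HB.pack V (isMeasurableFun.Build _ _ _ _ _ mV).
have mUV : measurable_fun setT (fun w => (U w, V w)) by exact: measurable_fun_pair.
pose W' : {mfun T >-> (R * R)%type} := HB.pack (fun w => (U w, V w))
  (isMeasurableFun.Build _ _ _ _ _ mUV).
have eqm : forall X, measurable X ->
    (distribution P U' \x distribution P V')%E X = distribution P W' X.
  apply: product_measure_unique => A B mA mB /=.
  by rewrite /distribution /pushforward /= -UV.
(* The absolute values make the integrand nonnegative on the whole plane; on the range of [(U, V)]
   they change nothing. *)
pose f (z : (R * R)%type) : \bar R := (`|z.1| * `|z.2|)%:E.
have mf : measurable_fun setT f.
  apply/measurable_EFinP; apply: measurable_funM; exact: measurableT_comp.
have f0 z : (0 <= f z)%E by rewrite lee_fin mulr_ge0.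
transitivity (\int[distribution P W']_z f z)%E.
  rewrite ge0_integral_distribution//; apply: eq_integral => w _ /=.
  by rewrite /f/= !ger0_norm.
transitivity (\int[distribution P U' \x distribution P V']_z f z)%E.
  by apply: eq_measure_integral => X mX _; apply/esym/eqm.
rewrite fubini_tonelli1// /fubini_F.
under eq_integral => x _.
  rewrite (_ : (\int[_]_y f (x, y) = `|x|%:E * \int[distribution P V']_y `|y|%:E)%E); last first.
    rewrite -ge0_integralZl_EFin//; last exact/measurable_EFinP.
  over.
rewrite ge0_integralZr//; last 2 first.
- exact/measurable_EFinP.
- by apply: integral_ge0 => y _; rewrite lee_fin.
rewrite !ge0_integral_distribution//; last 2 first.
- exact/measurable_EFinP.
- exact/measurable_EFinP.
congr (_ * _)%E; apply: eq_integral => w _ /=; by rewrite ger0_norm.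
Qed.

End Independence.

Section RandomLindley.
Context {d} {T : measurableType d} {R : realType} {n : nat}
  (x : T -> 'I_n -> nat -> R).

Lemma measurable_sum_cond I (s : seq I) (Q : pred I) (F : I -> T -> R) :
  (forall i, Q i -> measurable_fun setT (F i)) ->
  measurable_fun setT (fun w => \sum_(i <- s | Q i) F i w).
Proof.
move=> mF; under [fun w => _]funext => w do rewrite big_mkcond.
apply: measurable_sum => i; case: (boolP (Q i)) => // Qi; exact: mF.
Qed.

Lemma measurable_step_sum i j : (forall l, measurable_fun setT (fun w => x w l j)) ->
  measurable_fun setT (fun w => step_sum (x w) i j).
Proof. by move=> mx; apply: measurable_sum_cond. Qed.

(** Only the steps before [j] are required to be measurable, and [T] is arbitrary: taking for [T]
    the sigma-algebra generated by the first [j] increments shows that the state at [j] depends on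
    the past only. *)
Lemma measurable_lindley i j :
  (forall l k, (k < j)%N -> measurable_fun setT (fun w => x w l k)) ->
  measurable_fun setT (fun w => lindley (x w) i j).
Proof.
elim: j => [|j IH] mx //=; apply: measurable_maxr => //; apply: measurable_funD.
  by apply: IH => l k kj; apply: mx; rewrite ltnS ltnW.
by apply: measurable_step_sum => l; exact: mx.
Qed.

Lemma measurable_lindley_exp (alpha : 'I_n -> R) j :
  (forall l k, (k < j)%N -> measurable_fun setT (fun w => x w l k)) ->
  measurable_fun setT (fun w => lindley_exp (x w) alpha j).
Proof.
move=> mx; apply: measurableT_comp => //; apply: measurable_funN.
apply: measurable_sum_cond => i _; apply: measurable_funM => //.
exact: measurable_lindley.
Qed.

Lemma measurable_pushing i j : (forall l k, measurable_fun setT (fun w => x w l k)) ->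
  measurable_fun setT (fun w => pushing (x w) i j).
Proof.
move=> mx; apply: measurable_maxr => //; apply: measurable_funN.
by apply: measurable_funD; [exact: measurable_lindley|exact: measurable_step_sum].
Qed.

Lemma measurable_pushing_exp (alpha : 'I_n -> R) i j :
  (forall l k, measurable_fun setT (fun w => x w l k)) ->
  measurable_fun setT (fun w => pushing_exp (x w) alpha i j).
Proof.
move=> mx; apply: measurable_funM; last exact: measurable_pushing.
apply: measurableT_comp => //; apply: measurable_funN.
apply: measurable_sum_cond => l _; apply: measurable_funM => //.
exact: (measurable_lindley l j.+1).
Qed.

End RandomLindley.

(** * Increments over a grid *)

Section Increments.
Context {d} {Omega : measurableType d} {R : realType} (P : probability Omega R)
  {n : nat} (X : 'I_n -> R -> Omega -> R).
Implicit Types (t : nat -> R) (w : Omega) (Q : pred nat).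

Definition increments t w (i : 'I_n) (j : nat) : R := X i (t j.+1) w - X i (t j) w.

(** A pi-system generating the sigma-algebra of the increments over the cells in [Q]; used with [Q]
    the cells before [m] (the past) and with [Q] the cell [m] alone. *)
Definition rectangles t Q : set (set Omega) :=
  [set A | exists2 B : nat -> 'I_n -> set R, (forall j i, measurable (B j i)) &
    A = [set w | forall j i, Q j -> B j i (increments t w i j)]].

Lemma rectanglesI t Q : setI_closed (rectangles t Q).
Proof.
move=> _ _ [B mB ->] [B' mB' ->]; exists (fun j i => B j i `&` B' j i).
  by move=> j i; exact: measurableI.
apply/seteqP; split => w /=; first by move=> [h1 h2] j i Qj; split; [exact: h1|exact: h2].
by move=> h; split => j i Qj; have [] := h j i Qj.
Qed.

Lemma rectanglesT t Q : rectangles t Q setT.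
Proof. by exists (fun _ _ => setT) => //; apply/seteqP; split. Qed.

Hypothesis mX : forall i s, measurable_fun setT (X i s).

Lemma measurable_increments t i j : measurable_fun setT (fun w => increments t w i j).
Proof. by apply: measurable_funB; exact: mX. Qed.

Lemma rectangles_measurable t Q : rectangles t Q `<=` measurable.
Proof.
move=> _ [B mB ->].
rewrite (_ : [set _ | _] = \bigcap_(j in [set j | Q j]) \bigcap_i
    ((fun w => increments t w i j) @^-1` B j i)); last first.
  by apply/seteqP; split => w /= h j; [move=> Qj i _; exact: h|move=> i Qj; exact: (h j Qj i)].
apply: bigcap_measurableType => j _; apply: fin_bigcap_measurable => // i _.
by rewrite -[X in measurable X]setTI; exact: measurable_increments.
Qed.

Lemma rectangles_increments t Q i j : Q j ->
  measurable_fun (setT : set (g_sigma_algebraType (rectangles t Q)))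
    (fun w => increments t w i j).
Proof.
move=> Qj _ Y mY; rewrite setTI; apply: sub_sigma_algebra.
exists (fun j' i' => if (j' == j) && (i' == i) then Y else setT).
  by move=> j' i'; case: ifP.
apply/seteqP; split => w /= h; last by have := h j i Qj; rewrite !eqxx.
by move=> j' i' _; case: ifP => // /andP[/eqP-> /eqP->].
Qed.

Hypothesis Xindep : independent_increments P X.

(** The product formula over [m.+1] cells splits off its last factor, and the formula over [m] cells
    folds the others back into [P A]. *)
Lemma rectangles_indep t m A C : 0 <= t 0%N -> (forall j, t j <= t j.+1) ->
  rectangles t (fun j => (j < m)%N) A -> rectangles t (fun k => k == m) C ->
  P (A `&` C) = (P A * P C)%E.
Proof.
move=> t0 tS [B mB AE] [B' mB' CE].
have tS' k j : (j < k)%N -> t j <= t j.+1 by [].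
have := Xindep m t t0 (tS' m) (fun j => B j) (fun j => mB j).
have := Xindep m.+1 t t0 (tS' m.+1)
  (fun j => if (j < m)%N then B j else B' j) _.
set F := fun j : nat => P [set w | forall i, B j i (X i (t j.+1) w - X i (t j) w)].
rewrite big_ord_recr/= ltnn (eq_bigr (fun j : 'I_m => F j)); last first.
  by move=> j _; rewrite ltn_ord.
move=> h1 h2.
have -> : A `&` C = \bigcap_(j in [set: 'I_m.+1]) [set w | forall i,
    (if (j < m)%N then B j else B' j) i (X i (t j.+1) w - X i (t j) w)].
  rewrite AE CE; apply/seteqP; split => w /=.
    move=> [hA hC] j _ i /=; case: ltnP => jm; first exact: hA.
    have jE : j = m :> nat by apply/eqP; rewrite eqn_leq jm -ltnS ltn_ord.
    by rewrite jE; apply: hC.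
  move=> h; split => j i.
    by move=> jm; have /= := h (widen_ord (leqnSn m) (Ordinal jm)) I i; rewrite jm.
  by move=> /= /eqP ->; have /= := h ord_max I i; rewrite ltnn.
rewrite h1; last by move=> j i; case: ifP.
rewrite -h2; congr (P _ * P _)%E.
  rewrite AE; apply/seteqP; split => w /= h.
    by move=> j i jm; exact: (h (Ordinal jm) I i).
  by move=> j _ i; exact: h.
rewrite CE; apply/seteqP; split => w /= h; last by move=> i; exact: (h m i (eqxx _)).
by move=> j i /eqP ->; exact: h.
Qed.

(** Independence passes from rectangles to the generated sigma-algebras in two rounds, one event at
    a time, while the other stays fixed. *)
Lemma increments_integralM t m (U V : Omega -> R) :
  0 <= t 0%N -> (forall j, t j <= t j.+1) ->
  measurable_fun (setT : set (g_sigma_algebraType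
    (rectangles t (fun j => (j < m)%N)))) U ->
  measurable_fun (setT : set (g_sigma_algebraType (rectangles t (fun k => k == m)))) V ->
  (forall w, 0 <= U w) -> (forall w, 0 <= V w) ->
  (\int[P]_w (U w * V w)%:E = \int[P]_w (U w)%:E * \int[P]_w (V w)%:E)%E.
Proof.
move=> t0 tS mU mV U0 V0.
have sub Q (F : Omega -> R) (A : set R) : measurable A ->
    measurable_fun (setT : set (g_sigma_algebraType (rectangles t Q))) F ->
    <<s rectangles t Q >> (F @^-1` A).
  by move=> mA mF; have := mF measurableT A mA; rewrite setTI.
have sm Q A : <<s rectangles t Q >> A -> measurable A.
  exact: (smallest_sub (@sigma_algebra_measurable _ _) (rectangles_measurable t Q)).
have mf Q (F : Omega -> R) :
    measurable_fun (setT : set (g_sigma_algebraType (rectangles t Q))) F ->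
    measurable_fun setT F.
  by move=> mF _ A mA; rewrite setTI; apply: (sm Q); exact: sub.
apply: indep_integralM => //; [exact: mf mU|exact: mf mV|].
move=> A B mA mB.
apply: (sigma_algebra_indep P (rectangles t (fun j => (j < m)%N))).
- exact: rectangles_measurable.
- exact: rectanglesI.
- exact: rectanglesT.
- by apply: sm; exact: sub mV.
- move=> A' rA'; rewrite setIC muleC.
  apply: (sigma_algebra_indep P (rectangles t (fun k => k == m))) => //.
  + exact: rectangles_measurable.
  + exact: rectanglesI.
  + exact: rectanglesT.
  + exact: rectangles_measurable rA'.
  + by move=> C rC; rewrite setIC muleC; exact: (rectangles_indep t m).
  + exact: sub mV.
- exact: sub mU.
Qed.

End Increments.

(* The path properties are required of every path, not only almost surely. *)
Record levy_input {d} {Omega : measurableType d} {R : realType}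
  (P : probability Omega R) {n : nat} (X : 'I_n -> R -> Omega -> R)
  (phi : ('I_n -> R) -> R) : Prop := LevyInput {
  input_measurable : forall i t, measurable_fun setT (X i t) ;
  input0 : forall i w, X i 0 w = 0 ;
  input_cadlag : forall i w, cadlag (fun t => X i t w) ;
  input_stationary : stationary_increments P X ;
  input_independent : independent_increments P X ;
  input_nondecreasing : forall i : 'I_n, (0 < i)%N ->
    forall w, nondecreasing_on_Rplus (fun t => X i t w) ;
  input_no_negative_jumps : forall i : 'I_n, val i = 0%N ->
    forall w, no_negative_jumps (fun t => X i t w) ;
  input_laplace : laplace_exponent P X phi }.

(** * Laplace transforms of increments and the telescoped identity *)

Section LaplaceOfIncrements.
Context {d} {Omega : measurableType d} {R : realType} (P : probability Omega R)
  {n : nat} (X : 'I_n -> R -> Omega -> R) (phi : ('I_n -> R) -> R).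
Hypothesis inp : levy_input P X phi.
Implicit Types (S : 'I_n -> R) (s t : R).

Let mX := input_measurable _ _ _ inp.

Lemma laplace_input S t : (forall i, 0 <= S i) -> 0 <= t ->
  let f w := expR (- \sum_i S i * X i t w) in
  P.-integrable setT (EFin \o f) /\ \int[P]_w f w = expR (phi S * t).
Proof.
move=> S0 t0 f; have := input_laplace _ _ _ inp S S0 t t0 => Ef.
have mf : measurable_fun setT f.
  apply: measurableT_comp => //; apply: measurable_funN.
  by apply: measurable_sum_cond => i _; apply: measurable_funM.
split; last by rewrite /Rintegral Ef.
by apply: ge0_integrable_fin mf _ Ef => w; exact: expR_ge0.
Qed.

Lemma input_phi0 : phi (fun _ => 0) = 0.
Proof.
have [_] := laplace_input (fun _ => 0) 1 (fun _ => lexx 0) ler01.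
under [X in Rintegral _ _ X]funext => w.
  rewrite big1 ?oppr0 ?expR0; last by move=> i _; rewrite mul0r.
over.
by rewrite Rintegral_prob_cst mulr1 -[X in X = _]expR0 => /expR_inj.
Qed.

Let measurable_sum_increments (T : nat -> R) (Q : pred nat) S j : Q j ->
  measurable_fun (setT : set (g_sigma_algebraType (rectangles X T Q)))
    (fun w => expR (- \sum_i S i * increments X T w i j)).
Proof.
move=> Qj; apply: measurableT_comp => //; apply: measurable_funN.
apply: measurable_sum_cond => i _; apply: measurable_funM => //.
exact: rectangles_increments.
Qed.

(** Independence factors the transform at time [s + t] into that at time [s] and that of the
    increment; dividing leaves [expR (phi S * t)]. *)
Lemma laplace_increment S s t : (forall i, 0 <= S i) -> 0 <= s -> 0 <= t ->
  let f w := expR (- \sum_i S i * (X i (s + t) w - X i s w)) in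
  P.-integrable setT (EFin \o f) /\ \int[P]_w f w = expR (phi S * t).
Proof.
move=> S0 s0 t0 f.
(* The times 0, [s], [s + t], then constant: cell 0 is the past, cell 1 the increment. *)
pose T (j : nat) : R := if j is j'.+1 then (if j' is _.+1 then s + t else s) else 0.
have TS j : T j <= T j.+1 by case: j => [|[|j]] //=; rewrite lerDl.
pose U w := expR (- \sum_i S i * increments X T w i 0).
have UE w : U w = expR (- \sum_i S i * X i s w).
  congr (expR (- _)); apply: eq_bigr => i _.
  by rewrite /increments/= (input0 _ _ _ inp) subr0.
have [iU EU] := laplace_input S s S0 s0.
have [iW EW] := laplace_input S (s + t) S0 (addr_ge0 s0 t0).
have := increments_integralM P X mX (input_independent _ _ _ inp) T 1 U f (lexx 0) TS
  (measurable_sum_increments T _ S 0 isT)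
  (measurable_sum_increments T (fun k => k == 1%N) S 1 (eqxx _))
  (fun w => expR_ge0 _) (fun w => expR_ge0 _).
under eq_integral => w _.
  rewrite UE /f -expRD -opprD -big_split/=.
  rewrite (eq_bigr (fun i => S i * X i (s + t) w)); last by move=> i _; ring.
over.
under [X in (_ = X * _)%E]eq_integral => w _ do rewrite UE.
rewrite (EFin_Rintegral _ _ iW) (EFin_Rintegral _ _ iU) EU EW => Ef.
(* The integral is not yet known to be finite; the value [+oo] is excluded since its product with a
   positive number would be infinite. *)
have : (\int[P]_w (f w)%:E)%E = (expR (phi S * t))%:E.
  move: Ef; have : (0 <= \int[P]_w (f w)%:E)%E.
    by apply: integral_ge0 => w _; rewrite lee_fin expR_ge0.
  case: (\int[P]_w _)%E => [r| |] //= _.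
    rewrite -EFinM => -[]; rewrite mulrDr expRD => h; congr (_%:E).
    by apply/esym/(mulfI (lt0r_neq0 (expR_gt0 (phi S * s)))).
  by rewrite gt0_muley// lte_fin expR_gt0.
move=> {}Ef; split; last by rewrite /Rintegral Ef.
apply: ge0_integrable_fin Ef; last by move=> w; exact: expR_ge0.
apply: measurableT_comp => //; apply: measurable_funN.
by apply: measurable_sum_cond => i _; apply: measurable_funM => //; exact: measurable_funB.
Qed.

Context (delta : R).
Hypothesis delta0 : 0 <= delta.

Definition grid_increments := increments X (fun j => j%:R * delta).

Lemma measurable_grid i j : measurable_fun setT (fun w => grid_increments w i j).
Proof. exact: measurable_increments. Qed.

Lemma laplace_grid S j : (forall i, 0 <= S i) ->
  let f w := expR (- \sum_i S i * grid_increments w i j) in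
  P.-integrable setT (EFin \o f) /\ \int[P]_w f w = expR (phi S * delta).
Proof.
move=> S0 f; have jd : 0 <= j%:R * delta by rewrite mulr_ge0.
have := laplace_increment S (j%:R * delta) delta S0 jd delta0.
by rewrite /f /grid_increments /increments -natr1 mulrDl mul1r.
Qed.

Lemma grid_increments_ge0 w (i : 'I_n) j : (0 < i)%N -> 0 <= grid_increments w i j.
Proof.
move=> i0; rewrite subr_ge0; apply: (input_nondecreasing _ _ _ inp) => //.
  by rewrite mulr_ge0.
by rewrite ler_wpM2r// ler_nat.
Qed.

Context (alpha : 'I_n -> R).
Hypothesis ta : forall k : nat, 0 <= tailn alpha k.

Definition mean_lindley_exp j := \int[P]_w lindley_exp (grid_increments w) alpha j.

Definition mean_pushing_exp i j := \int[P]_w pushing_exp (grid_increments w) alpha i j.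

Let gi0 w := grid_increments_ge0 w.

Lemma integrable_lindley_exp j :
  P.-integrable setT (EFin \o (fun w => lindley_exp (grid_increments w) alpha j)).
Proof.
apply: (bounded_Rintegrable _ _ 1) => [|w].
  by apply: measurable_lindley_exp => l k _; exact: measurable_grid.
rewrite ger0_norm ?lindley_exp_ge0//; exact: lindley_exp_le1 (gi0 w) _ ta _.
Qed.

Lemma mean_lindley_exp_bound j : 0 <= mean_lindley_exp j <= 1.
Proof.
apply: Rintegral_le1 => [|w|w]; last 2 first.
- exact: lindley_exp_ge0.
- exact: lindley_exp_le1 (gi0 w) _ ta _.
by apply: measurable_lindley_exp => l k _; exact: measurable_grid.
Qed.

Lemma mean_lindley_exp0 : mean_lindley_exp 0 = 1.
Proof.
rewrite /mean_lindley_exp /lindley_exp.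
under [X in Rintegral _ _ X]funext => w.
  rewrite big1 ?oppr0 ?expR0; last by move=> i _; rewrite mulr0.
over.
exact: Rintegral_prob_cst.
Qed.

Lemma mean_lindley_exp_indep j :
  let f w := lindley_exp (grid_increments w) alpha j *
    expR (- \sum_(i < n) tailn alpha i * grid_increments w i j) in
  P.-integrable setT (EFin \o f) /\
  \int[P]_w f w = mean_lindley_exp j * expR (phit phi alpha * delta).
Proof.
move=> f; have [iV EV] := laplace_grid (tailv alpha) j (fun i => ta i).
have := increments_integralM P X mX (input_independent _ _ _ inp)
  (fun j => j%:R * delta) j _ _ _ _ _
  (measurable_sum_increments _ (fun k => k == j) (tailv alpha) j (eqxx _)).
move=> /(_ (fun w => lindley_exp (grid_increments w) alpha j)).
rewrite mul0r => /(_ (lexx 0)) H.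
have {}H := H (fun j => _) (measurable_lindley_exp (T := g_sigma_algebraType _) _ _ _ _)
  (fun w => lindley_exp_ge0 _ _ _) (fun w => expR_ge0 _).
have mf : measurable_fun setT f.
  apply: measurable_funM.
    by apply: measurable_lindley_exp => l k _; exact: measurable_grid.
  by have /integrableP[/measurable_EFinP] := iV.
have Ef : (\int[P]_w (f w)%:E = (mean_lindley_exp j * expR (phit phi alpha * delta))%:E)%E.
  rewrite EFinM -EV -!EFin_Rintegral//; last exact: integrable_lindley_exp.
  apply: H => [j'|l k kj].
    by rewrite ler_wpM2r// ler_nat.
  exact: rectangles_increments.
split; last by rewrite /Rintegral Ef.
by apply: ge0_integrable_fin mf _ Ef => w; rewrite mulr_ge0 ?expR_ge0.
Qed.

Lemma mean_pushing_step j :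
  let f w := lindley_exp (grid_increments w) alpha j.+1 *
    (expR (\sum_i alpha i * pushing (grid_increments w) i j) - 1) in
  P.-integrable setT (EFin \o f) /\
  \int[P]_w f w = mean_lindley_exp j - mean_lindley_exp j.+1
    + mean_lindley_exp j * (expR (phit phi alpha * delta) - 1).
Proof.
move=> f; have [iV EV] := mean_lindley_exp_indep j.
set g := (fun w => _) in iV EV.
have fE : f = fun w => g w - lindley_exp (grid_increments w) alpha j.+1.
  apply/funext => w; rewrite /f /g.
  have := lindley_exp_step (grid_increments w) alpha j; lra.
have i1 := integrable_lindley_exp j.+1.
rewrite fE; split; first exact: (integrableB _ iV i1).
rewrite RintegralB// EV -/(mean_lindley_exp j.+1) mulrBr mulr1.
move: (mean_lindley_exp j) (mean_lindley_exp j.+1) (_ * _).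
by move=> a b c; ring.
Qed.

Lemma sum_mean_pushing_step N :
  \sum_(j < N) \int[P]_w (lindley_exp (grid_increments w) alpha j.+1 *
    (expR (\sum_i alpha i * pushing (grid_increments w) i j) - 1)) =
  1 - mean_lindley_exp N +
  (\sum_(j < N) mean_lindley_exp j) * (expR (phit phi alpha * delta) - 1).
Proof.
elim: N => [|N IH]; first by rewrite !big_ord0 mean_lindley_exp0; ring.
rewrite big_ord_recr/= IH big_ord_recr/=.
have [_ /= ->] := mean_pushing_step N.
move: (mean_lindley_exp N) (mean_lindley_exp N.+1) (expR _ - 1) (\sum_(i < N) _).
by move=> a b c e; ring.
Qed.

End LaplaceOfIncrements.

(** * Small steps *)

Section FirstCoordinate.
Context {R : realType} {n : nat} (i0 : 'I_n).
Hypothesis i00 : val i0 = 0%N.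

Definition first_coord (c : R) : 'I_n -> R := fun i => if i == i0 then c else 0.

Lemma first_coord_sum c (F : 'I_n -> R) : \sum_i first_coord c i * F i = c * F i0.
Proof.
rewrite (bigD1 i0)//= /first_coord eqxx big1 ?addr0// => i /negbTE ->.
by rewrite mul0r.
Qed.

Lemma first_coord_ge0 c i : 0 <= c -> 0 <= first_coord c i.
Proof. by rewrite /first_coord; case: ifP. Qed.

Lemma step_sum_first (x : 'I_n -> nat -> R) j : step_sum x 0 j = x i0 j.
Proof.
rewrite /step_sum (big_pred1 i0)// => l.
by rewrite leqn0 /= -val_eqE /= i00.
Qed.

End FirstCoordinate.

Section ExpIncrements.
Context {R : realType}.

Lemma expR_sub1_norm (a : R) : `|expR a - 1| <= `|a| * expR `|a|.
Proof.
have h0 := expR_ge1Dx a; have h1 := expR_sub1_le a.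
have [a0|a0] := leP 0 a.
  by rewrite !ger0_norm//; lra.
have e1 : expR a <= 1 by rewrite -expR0 ler_expR ltW.
rewrite ler0_norm ?subr_le0// (ltr0_norm a0).
have e2 : 1 <= expR (- a) by rewrite -expR0 ler_expR; lra.
by apply: le_trans (_ : - a * 1 <= _); [lra|rewrite ler_wpM2l//; lra].
Qed.

(** A bound for the difference quotient of [expR (a * delta)] at 0, uniform over meshes [delta] up
    to 1. *)
Definition exp_rate (a : R) : R := `|a| * expR `|a|.

Lemma expR_sub1_scale (a delta : R) : 0 <= delta -> delta <= 1 ->
  `|expR (a * delta) - 1| <= delta * exp_rate a.
Proof.
move=> d0 d1; rewrite /exp_rate; apply: le_trans (expR_sub1_norm _) _.
rewrite normrM (ger0_norm d0) mulrA [delta * _]mulrC ler_wpM2l ?mulr_ge0//.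
by rewrite ler_expR ler_piMr.
Qed.

Lemma expR_taylor2_scale (a delta : R) : 0 <= delta -> delta <= 1 ->
  `|expR (a * delta) - 1 - a * delta| <= delta ^+ 2 * (a ^+ 2 * expR `|a|).
Proof.
move=> d0 d1; apply: le_trans (expR_taylor2 _) _.
rewrite exprMn normrM (ger0_norm d0) mulrA [delta ^+ 2 * _]mulrC.
apply: ler_wpM2l; first by rewrite mulr_ge0 ?sqr_ge0.
by rewrite ler_expR ler_piMr.
Qed.

(** A form of Bernoulli's inequality that turns a lower bound on [(1 - p) ^+ m] into an upper bound
    on [m%:R * p]. *)
Lemma exprn_bernoulli (p : R) m : 0 <= p -> p <= 1 ->
  (1 - p) ^+ m * (1 + m%:R * p) <= 1.
Proof.
move=> p0 p1; elim: m => [|m IH]; first by rewrite expr0 mul0r addr0 mulr1.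
apply: le_trans IH; rewrite exprSr -mulrA ler_wpM2l ?exprn_ge0 ?subr_ge0//.
rewrite -natr1; have : 0 <= (m%:R + 1) * p * p by rewrite !mulr_ge0.
move: (m%:R : R) => a; lra.
Qed.

End ExpIncrements.

Section SmallSteps.
Context {d} {Omega : measurableType d} {R : realType} (P : probability Omega R)
  {n : nat} (X : 'I_n -> R -> Omega -> R) (phi : ('I_n -> R) -> R) (i0 : 'I_n).
Hypothesis inp : levy_input P X phi.
Hypothesis i00 : val i0 = 0%N.

Let mX := input_measurable _ _ _ inp.

Definition drop_prob (eta delta : R) : R :=
  fine (P [set w | X i0 delta w < - eta]).

Let measurable_drop (f : Omega -> R) (eta : R) : measurable_fun setT f ->
  measurable [set w | f w < - eta].
Proof.
move=> mf; rewrite (_ : [set _ | _] = f @^-1` `]-oo, - eta[); last first.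
  by apply/seteqP; split => w /=; rewrite in_itv.
by rewrite -[X in measurable X]setTI; exact: mf.
Qed.

Lemma drop_prob_bound eta delta : 0 <= drop_prob eta delta <= 1.
Proof.
rewrite /drop_prob fine_ge0//= -lee_fin fineK ?fin_num_measure//.
  by apply: probability_le1; exact: measurable_drop.
exact: measurable_drop.
Qed.

(* Independence turns the almost sure absence of macroscopic drops along fine
   grids of [0, 1] into a rate: (1 - p)^m -> 1 forces m p -> 0. *)
Lemma drop_prob_small eta eps : 0 < eta -> 0 < eps ->
  \forall m \near \oo, m%:R * drop_prob eta (m%:R^-1) <= eps.
Proof.
move=> eta0 eps0.
pose B (i : 'I_n) : set R := if i == i0 then `[- eta, +oo[%classic else setT.
have mB i : measurable (B i) by rewrite /B; case: ifP.
pose t m (j : nat) : R := j%:R * m%:R^-1.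
pose D m := \bigcap_(j in [set: 'I_m])
  [set w | forall i, B i (X i (t m j.+1) w - X i (t m j) w)].
have DE m : D m = [set w | forall j : 'I_m, - eta <= increments X (t m) w i0 j].
  apply/seteqP; split => w /= h j.
    by have := h j I i0; rewrite /B eqxx /= in_itv/= andbT.
  by move=> _ i; rewrite /B; case: eqP => // ->; rewrite /= in_itv/= andbT; exact: h.
have mD m : measurable (D m).
  apply: fin_bigcap_measurable => // j _.
  rewrite (_ : [set _ | _] = \bigcap_i ((fun w => increments X (t m) w i j) @^-1` B i)).
    apply: fin_bigcap_measurable => // i _; rewrite -[X in measurable X]setTI.
    exact: measurable_increments.
  by apply/seteqP; split => w /= h i; [move=> _|]; exact: h.
have tS m j : t m j.+1 = t m j + m%:R^-1 by rewrite /t -natr1 mulrDl mul1r.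
have t0 m j : 0 <= t m j by rewrite mulr_ge0.
have PD m : P (D m) = ((1 - drop_prob eta (m%:R^-1)) ^+ m)%:E.
  rewrite /D (input_independent _ _ _ inp m (t m) _ _ (fun _ => B))//; last first.
    by move=> j _; rewrite tS lerDl.
  rewrite -[X in _ ^+ X]card_ord -prodr_const -prodEFin; apply: eq_bigr => j _; rewrite tS.
  rewrite (input_stationary _ _ _ inp (t m j) (m%:R^-1) (t0 m j))//.
  rewrite (_ : [set _ | _] = ~` [set w | X i0 m%:R^-1 w < - eta]); last first.
    apply/seteqP; split => w /=.
      by move=> /(_ i0); rewrite /B eqxx/= in_itv/= andbT leNgt => /negP.
    move=> h i; rewrite /B; case: eqP => // ->; rewrite /= in_itv/= andbT leNgt.
    exact/negP.
  rewrite probability_setC; last exact: measurable_drop.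
  by rewrite EFinB /drop_prob fineK// fin_num_measure//; exact: measurable_drop.
have cD : \int[P]_w (\1_(D m) w : R) @[m --> \oo] --> \int[P]_w (1 : R).
  apply: (Rintegral_dominated _ _ _ (fun _ => 1)).
  - by move=> m; exact: measurable_indic.
  (* Each path has a downward modulus on [0, 1], so every [w] lies in [D m] for all large [m]; hence
     [P (D m)] tends to 1. *)
  - move=> w; apply: (cvg_near_cst).
    have i0c := input_cadlag _ _ _ inp i0 w.
    have [d0 d00 hd] := cadlag_downward_modulus _ 1 _ i0c
      (input_no_negative_jumps _ _ _ inp i0 i00 w) eta0.
    near=> m; have m0 : (0 < m)%N by near: m; exact: nbhs_infty_gt.
    have md : (m%:R^-1 : R) <= d0.
      rewrite invf_ple ?posrE ?ltr0n//; near: m; exact: nbhs_infty_ger.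
    rewrite indicE mem_set// DE => j /=; rewrite /increments.
    have tm1 : t m j.+1 <= 1 by rewrite /t ler_pdivrMr ?ltr0n// mul1r ler_nat.
    have le1 : t m j <= t m j.+1 by rewrite tS lerDl.
    have le2 : t m j.+1 - t m j <= d0 by rewrite tS addrAC subrr add0r.
    by have := hd _ _ (t0 m j) le1 tm1 le2; lra.
  - exact: cst_integrable.
  - by move=> m w; rewrite ger0_norm// indicE; case: (_ \in _).
move: cD; rewrite Rintegral_prob_cst => /cvgrPdist_lt.
(* Chosen because [1 - eps / (1 + eps) = 1 / (1 + eps)], with which Bernoulli's inequality gives
   exactly [m%:R * p <= eps]. *)
have e1 : 0 < eps / (1 + eps) by rewrite divr_gt0// addr_gt0.
move=> /(_ _ e1); apply: filterS => m.
have -> : \int[P]_w (\1_(D m) w : R) = (1 - drop_prob eta (m%:R^-1)) ^+ m.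
  by rewrite /Rintegral integral_indic// setIT; exact: (congr1 fine (PD m)).
set p := drop_prob _ _; have /andP[p0 p1] : 0 <= p <= 1 by exact: drop_prob_bound.
move=> h; have {}h : 1 - eps / (1 + eps) < (1 - p) ^+ m.
  by have := le_lt_trans (ler_norm _) h; lra.
have eps1 : 0 < 1 + eps by rewrite addr_gt0.
have {}h : 1 / (1 + eps) < (1 - p) ^+ m.
  apply: le_lt_trans h; rewrite le_eqVlt; apply/orP; left; apply/eqP.
  by field; rewrite gt_eqF.
have b := exprn_bernoulli p m p0 p1.
have mp : 0 < 1 + m%:R * p by rewrite ltr_wpDr// mulr_ge0.
have : 1 / (1 + eps) * (1 + m%:R * p) <= 1.
  by apply: le_trans b; rewrite ler_wpM2r ?ltW.
by rewrite mulrAC ler_pdivrMr// !mul1r lerD2l.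
Unshelve. all: by end_near. Qed.

Context (delta : R).
Hypothesis delta0 : 0 <= delta.
Local Notation gi := (grid_increments X delta).

Lemma drop_prob_grid eta j :
  fine (P [set w | gi w i0 j < - eta]) = drop_prob eta delta.
Proof.
rewrite /drop_prob; congr fine.
have jd : 0 <= j%:R * delta by rewrite mulr_ge0.
pose B (i : 'I_n) : set R := if i == i0 then `]-oo, - eta[%classic else setT.
have := input_stationary _ _ _ inp (j%:R * delta) delta jd delta0 B.
have EB (F : 'I_n -> Omega -> R) :
    [set w | forall i, B i (F i w)] = [set w | F i0 w < - eta].
  apply/seteqP; split => w /= h; first by have := h i0; rewrite /B eqxx/= in_itv.
  by move=> i; rewrite /B; case: eqP => // ->; rewrite /= in_itv.
rewrite (EB (fun i w => X i (j%:R * delta + delta) w - X i (j%:R * delta) w)).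
rewrite (EB (fun i w => X i delta w)) => <-; last by move=> i; rewrite /B; case: ifP.
by rewrite /grid_increments /increments -natr1 mulrDl mul1r.
Qed.

Lemma laplace_first c j : 0 <= c ->
  P.-integrable setT (EFin \o (fun w => expR (- (c * gi w i0 j)))) /\
  \int[P]_w expR (- (c * gi w i0 j)) = expR (phi (first_coord i0 c) * delta).
Proof.
move=> c0; have := laplace_grid P X phi inp delta delta0 (first_coord i0 c) j
  (fun i => first_coord_ge0 i0 c i c0).
by under [fun w => expR _]funext => w do rewrite first_coord_sum.
Qed.

(** With [e = expR (- (c * x))], [x] the increment, the square is [(e ^+ 2 - 1) - 2 * (e - 1)]. The
    constants have cancelled, and each bracket has a mean of order [delta]. *)
Lemma sqr_exp_first c j : 0 <= c -> delta <= 1 ->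
  let f w := (expR (- (c * gi w i0 j)) - 1) ^+ 2 in
  let l a := exp_rate (phi (first_coord i0 a)) in
  P.-integrable setT (EFin \o f) /\
  \int[P]_w f w <= delta * (l (2 * c) + 2 * l c).
Proof.
move=> c0 d1 f l; have [i1 E1] := laplace_first c j c0.
have [i2 E2] := laplace_first (2 * c) j (mulr_ge0 (ler0n R 2) c0).
have fE : f = fun w => expR (- (2 * c * gi w i0 j)) - (2 * expR (- (c * gi w i0 j)) - 1).
  apply/funext => w; rewrite /f.
  rewrite (_ : - (2 * c * _) = - (c * gi w i0 j) + - (c * gi w i0 j)); last by ring.
  by rewrite expRD; move: (expR _) => e; ring.
have i12 : P.-integrable setT (EFin \o (fun w => 2 * expR (- (c * gi w i0 j)) - 1)).
  exact: (integrableB measurableT (integrableZl measurableT 2 i1) (cst_integrable P 1)).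
rewrite fE; split; first exact: (integrableB measurableT i2 i12).
rewrite RintegralB// RintegralB//; last 2 first.
- exact: (integrableZl measurableT 2 i1).
- exact: cst_integrable.
rewrite RintegralZl// E1 E2 Rintegral_prob_cst.
have h1 := expR_sub1_scale (phi (first_coord i0 c)) _ delta0 d1.
have h2 := expR_sub1_scale (phi (first_coord i0 (2 * c))) _ delta0 d1.
rewrite -/(l c) in h1; rewrite -/(l (2 * c)) in h2.
rewrite (_ : delta * (_ + _) = delta * l (2 * c) + 2 * (delta * l c)); last by ring.
move: (ler_norm (expR (phi (first_coord i0 (2 * c)) * delta) - 1)).
move: (ler_norm (- (expR (phi (first_coord i0 c) * delta) - 1))); rewrite normrN.
move: h1 h2; move: (delta * l c) (delta * l (2 * c)) => b1 b2.
move: (expR (_ * delta)) (expR (_ * delta)) => a b.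
move: (`|_|) (`|_|) => n1 n2; lra.
Qed.

Lemma integrable_pushing i j :
  P.-integrable setT (EFin \o (fun w => pushing (gi w) i j)).
Proof.
have [i1 _] := laplace_first 1 j ler01.
apply: (le_Rintegrable _ _ _ _ _ i1) => [|w].
  by apply: measurable_pushing => l k; exact: (measurable_grid P X phi inp).
rewrite ger0_norm ?pushing_ge0//.
apply: le_trans (pushing_le _ (fun i j => grid_increments_ge0 P X phi inp _ delta0 w i j) _ _) _.
rewrite (step_sum_first i0)// ge_max expR_ge0/= mul1r.
by have := expR_ge1Dx (- gi w i0 j); lra.
Qed.

Lemma integrable_pushing_exp alpha i j : (forall k : nat, 0 <= tailn alpha k) ->
  P.-integrable setT (EFin \o (fun w => pushing_exp (gi w) alpha i j)).
Proof.
move=> ta; apply: (le_Rintegrable _ _ _ _ _ (integrable_pushing i j)) => [|w].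
  by apply: measurable_pushing_exp => l k; exact: (measurable_grid P X phi inp).
rewrite ger0_norm ?pushing_exp_ge0//; apply: pushing_exp_le => // i' j'.
exact: (grid_increments_ge0 P X phi inp).
Qed.

(** The telescoped identity for [alpha = (1, 0, ..., 0)]: after a push the first coordinate is 0, so
    each summand is [expR p - 1 >= p] with [p] the push. Total pushing therefore grows at most
    linearly in time. *)
Lemma sum_mean_pushing_first N : delta <= 1 ->
  \sum_(j < N) \int[P]_w pushing (gi w) 0 j <=
  1 + N%:R * delta * exp_rate (phit phi (first_coord i0 1)).
Proof.
move=> d1; set a1 := first_coord i0 1.
have ta1 (k : nat) : 0 <= tailn a1 k by apply: sumr_ge0 => i _; exact: first_coord_ge0.
have H := sum_mean_pushing_step P X phi inp delta delta0 a1 ta1 N.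
apply: le_trans (_ : 1 - mean_lindley_exp P X delta a1 N +
  (\sum_(j < N) mean_lindley_exp P X delta a1 j) *
  (expR (phit phi a1 * delta) - 1) <= _).
  rewrite -H; apply: ler_sum => j _.
  have [iS _] := mean_pushing_step P X phi inp delta delta0 a1 ta1 j.
  apply: le_Rintegral => //; first exact: integrable_pushing.
  move=> w _; rewrite /lindley_exp !first_coord_sum !mul1r i00.
  have [->|p0] := eqVneq (pushing (gi w) 0 j) 0; first by rewrite expR0 subrr mulr0.
  rewrite (lindley_pushing _ _ _ p0) oppr0 expR0 mul1r.
  by have := expR_ge1Dx (pushing (gi w) 0 j); lra.
have hb j := mean_lindley_exp_bound P X phi inp delta delta0 a1 ta1 j.
have := hb N => /andP[h0 _].
apply: lerD; first by lra.
apply: le_trans (ler_norm _) _; rewrite normrM -mulrA; apply: ler_pM => //.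
  have s0 : 0 <= \sum_(j < N) mean_lindley_exp P X delta a1 j.
    by apply: sumr_ge0 => j _; have /andP[] := hb j.
  rewrite (ger0_norm s0).
  rewrite -[N in leRHS]card_ord -sumr_const; apply: ler_sum => j _.
  by have /andP[] := hb j.
exact: expR_sub1_scale.
Qed.

Lemma mean_pushing_error alpha (eta K : R) j :
  (forall k : nat, 0 <= tailn alpha k) -> 0 < eta -> 0 < K -> delta <= 1 ->
  let A := \sum_(i < n) `|alpha i| in
  let Q := 2 * ((1 - expR (- (A + 1) * eta)) ^- 2 / K) in
  let l a := exp_rate (phi (first_coord i0 a)) in
  `| \int[P]_w (lindley_exp (gi w) alpha j.+1 *
       (expR (\sum_i alpha i * pushing (gi w) i j) - 1))
     - \sum_i alpha i * mean_pushing_exp P X delta alpha i j | <=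
  A ^+ 2 * (eta * expR (A * eta) * \int[P]_w pushing (gi w) 0 j +
    (2 * K * drop_prob eta delta + Q * (delta * (l (2 * (A + 1)) + 2 * l (A + 1))))).
Proof.
move=> ta eta0 K0 d1; cbv zeta.
set A := \sum_(i < n) `|alpha i|; set Q := 2 * (_ / K).
pose l a := exp_rate (phi (first_coord i0 a)).
rewrite -/(l (2 * (A + 1))) -/(l (A + 1)).
have [iS _] := mean_pushing_step P X phi inp delta delta0 alpha ta j.
have [iP EP] := Rintegral_sum P _ (index_enum 'I_n)
  (fun i w => alpha i * pushing_exp (gi w) alpha i j)
  (fun i => integrableZl measurableT (alpha i) (integrable_pushing_exp alpha i j ta)).
have -> : \sum_i alpha i * mean_pushing_exp P X delta alpha i j =
    \int[P]_w \sum_i alpha i * pushing_exp (gi w) alpha i j.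
  rewrite EP; apply: eq_bigr => i _; rewrite RintegralZl//.
  exact: integrable_pushing_exp.
have A0 : 0 <= A by apply: sumr_ge0.
have A1 : 0 <= A + 1 by lra.
have [iq Eq] := sqr_exp_first (A + 1) j A1 d1.
have mI : measurable [set w | gi w i0 j < - eta].
  by apply: measurable_drop; exact: (measurable_grid P X phi inp).
have iI : P.-integrable setT (EFin \o (\1_[set w | gi w i0 j < - eta] : Omega -> R)).
  exact: integrable_indic.
have iIZ := integrableZl measurableT (2 * K) iI.
have iqZ := integrableZl measurableT Q iq.
have ip := integrable_pushing 0 j.
have ipZ := integrableZl measurableT (eta * expR (A * eta)) ip.
have iIq := integrableD measurableT iIZ iqZ.
have iall := integrableD measurableT ipZ iIq.
have iallZ := integrableZl measurableT (A ^+ 2) iall.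
rewrite -RintegralB//.
pose F w := lindley_exp (gi w) alpha j.+1 *
  (expR (\sum_i alpha i * pushing (gi w) i j) - 1) -
  \sum_i alpha i * pushing_exp (gi w) alpha i j.
have iF : P.-integrable setT (EFin \o F) by exact: (integrableB measurableT iS iP).
apply: le_trans (le_normr_Rintegral measurableT iF) _.
pose G w := A ^+ 2 * (eta * expR (A * eta) * pushing (gi w) 0 j +
  (2 * K * \1_[set w | gi w i0 j < - eta] w +
   Q * (expR (- ((A + 1) * gi w i0 j)) - 1) ^+ 2)).
have iG : P.-integrable setT (EFin \o G) by exact: iallZ.
apply: le_trans (_ : \int[P]_w G w <= _).
  apply: le_Rintegral => //; first exact: (integrable_norm iF).
  move=> w _.
  have := pushing_error (gi w) (fun i j => grid_increments_ge0 P X phi inp _ delta0 w i j)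
    alpha ta eta K j eta0 K0.
  cbv zeta; rewrite -/A !(step_sum_first i0)// /G indicE.
  by rewrite (_ : (w \in _) = (gi w i0 j < - eta))//; apply/idP/idP; rewrite inE.
rewrite /G RintegralZl// RintegralD// RintegralD// (RintegralZl _ measurableT ip).
rewrite (RintegralZl _ measurableT iI) (RintegralZl _ measurableT iq).
have -> : \int[P]_w (\1_[set w | gi w i0 j < - eta] w : R) = drop_prob eta delta.
  by rewrite /Rintegral integral_indic// setIT; exact: drop_prob_grid.
apply: ler_wpM2l; first exact: sqr_ge0.
rewrite !lerD2l; apply: ler_wpM2l => //.
by rewrite mulr_ge0// divr_ge0 ?invr_ge0 ?sqr_ge0// ltW.
Qed.

End SmallSteps.

(** * The asymptotic identity *)

(** Dividing by [1 + a] instead of [a] gives tolerances that also make sense for [a = 0]. *)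
Lemma mulr_div1D_le {R : realFieldType} (a e : R) : 0 <= a -> 0 <= e ->
  a * (e / (1 + a)) <= e.
Proof.
move=> a0 e0; rewrite mulrA ler_pdivrMr; last by rewrite ltr_pwDl.
by rewrite mulrC ler_wpM2l// lerDr.
Qed.

Lemma sum_ltn_le {R : realDomainType} N M : \sum_(j < N) (j < M)%:R <= M%:R :> R.
Proof.
suff : \sum_(j < N) (j < M)%:R <= (minn N M)%:R :> R.
  by move/le_trans; apply; rewrite ler_nat geq_minr.
elim: N => [|N IH]; first by rewrite big_ord0.
rewrite big_ord_recr/=; apply: le_trans (lerD IH (lexx _)) _.
by rewrite -natrD ler_nat; case: (ltnP N M) => h /=; lia.
Qed.

Section AsymptoticIdentity.
Context {d} {Omega : measurableType d} {R : realType} (P : probability Omega R)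
  {n : nat} (X : 'I_n -> R -> Omega -> R) (phi : ('I_n -> R) -> R) (i0 : 'I_n).
Hypothesis inp : levy_input P X phi.
Hypothesis i00 : val i0 = 0%N.
Implicit Types (alpha : 'I_n -> R) (K m : nat).

Definition avg_lindley alpha K m : R :=
  (\sum_(j < K * m) mean_lindley_exp P X (m%:R^-1) alpha j) / (K * m)%:R.

(** Divided by the elapsed time [K], not by the number [K * m] of cells: a rate per unit time. *)
Definition avg_pushing alpha i K m : R :=
  (\sum_(j < K * m) mean_pushing_exp P X (m%:R^-1) alpha i j) / K%:R.

(** Four errors get [eps / 4] each: small pushes, exponential tails, large drops, and the
    linearization of [expR (phit phi alpha * delta)]. The cutoff [eta] is fixed first, then [kappa],
    whose bound involves [eta], and [m] last, since the drop probability is weighted by [kappa]. All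
    errors are proportional to [K], so the threshold for [m] is independent of [K]; [K%:R^-1] is
    what the telescoping leaves. *)
Lemma asymptotic_identity alpha eps : (forall k : nat, 0 <= tailn alpha k) ->
  0 < eps -> \forall m \near \oo, forall K, (0 < K)%N ->
  `| phit phi alpha * avg_lindley alpha K m - \sum_i alpha i * avg_pushing alpha i K m |
    <= K%:R^-1 + eps.
Proof.
have fin (x1 x2 x3 x4 x5 e : R) : x1 <= x2 + (x3 + x4) ->
    x2 <= e -> x3 <= e -> x4 <= e -> x5 <= e -> x1 + (1 + x5) <= 1 + e * 4.
  by move=> *; lra.
move=> ta eps0.
set A := \sum_(i < n) `|alpha i|; have A0 : 0 <= A by apply: sumr_ge0.
pose C1 := exp_rate (phit phi (first_coord i0 (1 : R))).
pose l a := exp_rate (phi (first_coord i0 a)).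
pose C2 := l (2 * (A + 1)) + 2 * l (A + 1).
pose C3 := phit phi alpha ^+ 2 * expR `|phit phi alpha|.
have er0 a : 0 <= exp_rate a :> R by rewrite mulr_ge0 ?expR_ge0.
have C10 : 0 <= C1 by exact: er0.
have C20 : 0 <= C2 by rewrite addr_ge0 ?mulr_ge0 ?er0.
have C30 : 0 <= C3 by rewrite mulr_ge0 ?sqr_ge0 ?expR_ge0.
have e40 : 0 < eps / 4 by rewrite divr_gt0.
pose D1 := A ^+ 2 * (expR A * (1 + C1)).
have D10 : 0 <= D1 by rewrite !mulr_ge0 ?sqr_ge0 ?expR_ge0 ?addr_ge0.
pose eta := Num.min 1 (eps / 4 / (1 + D1)).
have eta0 : 0 < eta by rewrite lt_min ltr01 divr_gt0// ltr_pwDl.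
have eta1 : eta <= 1 by rewrite ge_min lexx.
pose q := (1 - expR (- (A + 1) * eta)) ^- 2.
have q0 : 0 <= q by rewrite invr_ge0 sqr_ge0.
pose D2 := A ^+ 2 * (2 * q * C2).
have D20 : 0 <= D2 by rewrite !mulr_ge0 ?sqr_ge0.
pose kappa := (1 + D2) / (eps / 4).
have kappa0 : 0 < kappa by rewrite divr_gt0// ltr_pwDl.
pose D3 := A ^+ 2 * (2 * kappa).
have D30 : 0 <= D3 by apply: mulr_ge0; [exact: sqr_ge0|apply: mulr_ge0 => //; exact: ltW].
have e50 : 0 < eps / 4 / (1 + D3) by rewrite divr_gt0// ltr_pwDl.
near=> m.
have m0 : (0 < m)%N by near: m; exact: nbhs_infty_gt.
have mR : 0 < m%:R :> R by rewrite ltr0n.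
have dp : m%:R * drop_prob P X i0 eta (m%:R^-1) <= eps / 4 / (1 + D3).
  by near: m; exact: (drop_prob_small P X phi i0 inp i00 eta _ eta0 e50).
have C3m : C3 * m%:R^-1 <= eps / 4.
  rewrite ler_pdivrMr// mulrC -ler_pdivrMr//; near: m; exact: nbhs_infty_ger.
move=> K K0.
have KR : 0 < K%:R :> R by rewrite ltr0n.
have K1 : 1 <= K%:R :> R by rewrite ler1n.
set delta : R := m%:R^-1 in dp C3m *.
have d0 : 0 <= delta by rewrite invr_ge0.
have d1 : delta <= 1 by rewrite invf_le1// ler1n.
set p := drop_prob P X i0 eta delta in dp *.
pose h j := mean_lindley_exp P X delta alpha j.
pose b j := \sum_i alpha i * mean_pushing_exp P X delta alpha i j.
pose s j := \int[P]_w (lindley_exp (grid_increments X delta w) alpha j.+1 *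
    (expR (\sum_i alpha i * pushing (grid_increments X delta w) i j) - 1)).
set N := (K * m)%N.
have NR : N%:R * delta = K%:R by rewrite /N natrM mulfK// gt_eqF.
have Sh : \sum_(j < N) s j = 1 - h N +
    (\sum_(j < N) h j) * (expR (phit phi alpha * delta) - 1).
  exact: (sum_mean_pushing_step P X phi inp delta d0 alpha ta N).
have hb j : 0 <= h j <= 1 by exact: (mean_lindley_exp_bound P X phi inp).
have sumh0 : 0 <= \sum_(j < N) h j by apply: sumr_ge0 => j _; have /andP[] := hb j.
have sumhN : \sum_(j < N) h j <= N%:R.
  rewrite -[N in leRHS]card_ord -sumr_const; apply: ler_sum => j _.
  by have /andP[] := hb j.
have err : `|\sum_(j < N) s j - \sum_(j < N) b j| <=
    A ^+ 2 * (eta * expR (A * eta) * (1 + K%:R * C1) +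
      K%:R * (2 * kappa * (m%:R * p) + 2 * (q / kappa) * C2)).
  rewrite -sumrB; apply: le_trans (ler_norm_sum _ _ _) _.
  apply: le_trans (_ : \sum_(j < N) A ^+ 2 * (eta * expR (A * eta) *
    (\int[P]_w pushing (grid_increments X delta w) 0 j) +
    (2 * kappa * p + 2 * (q / kappa) * (delta * C2))) <= _).
    apply: ler_sum => j _.
    exact: (mean_pushing_error P X phi i0 inp i00 delta d0 alpha eta kappa j ta eta0 kappa0 d1).
  rewrite -mulr_sumr big_split/= -mulr_sumr sumr_const card_ord.
  apply: ler_wpM2l; first exact: sqr_ge0.
  apply: lerD.
    apply: ler_wpM2l; first by rewrite mulr_ge0 ?expR_ge0// ltW.
    have := sum_mean_pushing_first P X phi i0 inp i00 delta d0 N d1.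
    by rewrite -[N%:R * delta]/(N%:R * delta) NR.
  rewrite -[_ *+ N]mulr_natl -NR le_eqVlt; apply/orP; left; apply/eqP.
  have dm : delta * m%:R = 1 by rewrite mulVf// gt_eqF.
  transitivity (N%:R * (2 * kappa * p * (delta * m%:R) + 2 * (q / kappa) * (delta * C2))).
    by rewrite dm mulr1.
  by move: (q / kappa) => x2; ring.
have sumE : phit phi alpha * avg_lindley alpha K m - \sum_i alpha i * avg_pushing alpha i K m
   = (phit phi alpha * delta * (\sum_(j < N) h j) - \sum_(j < N) b j) / K%:R.
  rewrite mulrBl; congr (_ - _).
    rewrite /avg_lindley -/delta -/N natrM invfM -/delta -/(h _).
    by rewrite -/delta; move: (\sum_(j < N) _) => z; ring.
  rewrite /b exchange_big/= mulr_suml; apply: eq_bigr => i _.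
  by rewrite /avg_pushing -/delta -/N mulrA mulr_sumr.
rewrite sumE normrM [`|K%:R^-1|]gtr0_norm ?invr_gt0// ler_pdivrMr// mulrDl mulVf ?gt_eqF//.
have t2 := expR_taylor2_scale (phit phi alpha) _ d0 d1; rewrite -/C3 in t2.
apply: le_trans (_ : `|\sum_(j < N) s j - \sum_(j < N) b j| + (1 +
    N%:R * (delta ^+ 2 * C3)) <= _).
  rewrite (_ : _ - _ = (\sum_(j < N) s j - \sum_(j < N) b j) - ((1 - h N) +
    (\sum_(j < N) h j) * (expR (phit phi alpha * delta) - 1 - phit phi alpha * delta))).
    apply: le_trans (ler_normB _ _) _; rewrite lerD2l.
    apply: le_trans (ler_normD _ _) _; apply: lerD.
      by have /andP[h0 h1] := hb N; rewrite ger0_norm ?subr_ge0// gerBl.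
    by rewrite normrM ger0_norm//; apply: ler_pM.
  rewrite Sh; move: (\sum_(j < N) h j) (\sum_(j < N) b j) (h N) (expR _) => x1 x2 x3 x4.
  by ring.
rewrite (_ : N%:R * (delta ^+ 2 * C3) = K%:R * (C3 * delta)); last by rewrite -NR; ring.
have b4 : K%:R * (C3 * delta) <= K%:R * (eps / 4) by rewrite ler_pM2l.
have b1 : A ^+ 2 * (eta * expR (A * eta) * (1 + K%:R * C1)) <= K%:R * (eps / 4).
  apply: le_trans (_ : K%:R * (D1 * eta) <= _).
    rewrite /D1 [leRHS](_ : _ = A ^+ 2 * (eta * expR A * (K%:R * (1 + C1)))); last by ring.
    apply: ler_wpM2l; first exact: sqr_ge0.
    apply: ler_pM; rewrite ?mulr_ge0 ?addr_ge0 ?expR_ge0 ?mulr_ge0//; last 2 first.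
    - by rewrite ler_wpM2l ?(ltW eta0)// ler_expR ler_piMr.
    - by rewrite mulrDr mulr1 lerD2r.
    exact: ltW.
  rewrite ler_pM2l//; apply: le_trans (mulr_div1D_le _ _ D10 (ltW e40)).
  by rewrite ler_wpM2l// ge_min lexx orbT.
have b2 : A ^+ 2 * (K%:R * (2 * kappa * (m%:R * p))) <= K%:R * (eps / 4).
  rewrite (_ : _ * _ = K%:R * (D3 * (m%:R * p))); last by rewrite /D3; ring.
  rewrite ler_pM2l//; apply: le_trans (mulr_div1D_le _ _ D30 (ltW e40)).
  exact: ler_wpM2l.
have b3 : A ^+ 2 * (K%:R * (2 * (q / kappa) * C2)) <= K%:R * (eps / 4).
  rewrite (_ : _ * _ = K%:R * (D2 / kappa)); last by rewrite /D2; ring.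
  rewrite ler_pM2l// /kappa invf_div; exact: mulr_div1D_le D20 (ltW e40).
rewrite (_ : eps * K%:R = K%:R * (eps / 4) * 4); last first.
  by rewrite -mulrA divfK// mulrC.
apply: fin b1 b2 b3 b4; apply: le_trans err _.
rewrite le_eqVlt; apply/orP; left; apply/eqP.
by rewrite mulrDr; congr (_ + _); rewrite mulrDr mulrDr.
Unshelve. all: by end_near. Qed.

End AsymptoticIdentity.

(** * Convergence to the steady state *)

Lemma cvg_big_sum {R : realType} {T : Type} {F : set_system T} {FF : Filter F}
    {I : Type} (s : seq I) (f : I -> T -> R) (a : I -> R) :
  (forall i, f i x @[x --> F] --> a i) ->
  (\sum_(i <- s) f i x) @[x --> F] --> \sum_(i <- s) a i.
Proof.
move=> fa; elim: s => [|i s IH].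
  by rewrite big_nil; under [X in X @ _]funext => x do rewrite big_nil; exact: cvg_cst.
rewrite big_cons; under [X in X @ _]funext => x do rewrite big_cons.
exact: (cvgD (fa i) IH).
Qed.

(** * Measurability of the reflected process *)

Section MeasurableRunningInf.
Context {d} {Omega : measurableType d} {R : realType}.

Fixpoint seq_min (u : nat -> R) N : R :=
  if N is N'.+1 then Num.min (seq_min u N') (u N) else u 0%N.

Lemma seq_min_le u N j : (j <= N)%N -> seq_min u N <= u j.
Proof.
elim: N => [|N IH]; first by rewrite leqn0 => /eqP ->.
rewrite leq_eqVlt => /orP[/eqP->|/IH h] /=; first by rewrite ge_min lexx orbT.
by rewrite ge_min h.
Qed.

Lemma seq_min_ge u N a : (forall j, (j <= N)%N -> a <= u j) -> a <= seq_min u N.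
Proof.
elim: N => [|N IH] h /=; first exact: h.
by rewrite le_min h// IH// => j jN; apply: h; exact: leqW.
Qed.

(** By right-continuity the infimum over the uncountable interval is the limit of minima over finer
    and finer grids: a point that nearly attains it has grid points just to its right. *)
Lemma measurable_running_inf (Y : R -> Omega -> R) t :
  (forall s, measurable_fun setT (Y s)) -> (forall w, cadlag (Y^~ w)) -> 0 <= t ->
  measurable_fun setT (fun w => running_inf (Y^~ w) t).
Proof.
move=> mY Yc t0; pose s (m j : nat) := j%:R * (t / m.+1%:R).
have s0 m j : 0 <= s m j by rewrite mulr_ge0// divr_ge0.
have st m j : (j <= m.+1)%N -> s m j <= t.
  move=> jm; rewrite /s mulrCA ler_piMr// ler_pdivrMr// mul1r ler_nat//.
apply: (@measurable_fun_cvg _ _ _ setT (fun m w => seq_min (fun j => Y (s m j) w) m.+1)).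
  move=> m; elim: (m.+1) => [|N IH] /=; first exact: mY.
  by apply: measurable_minr => //; exact: mY.
move=> w _; apply/cvgrPdist_le => eps eps0; set I := running_inf _ _.
have e20 : 0 < eps / 2 by rewrite divr_gt0.
have [u u0 [ut hu]] : exists2 u, 0 <= u & u <= t /\ Y u w < I + eps / 2.
  apply: contrapT => h; suff : I + eps / 2 <= I by lra.
  apply: running_inf_ge => // r r0 rt; rewrite leNgt; apply/negP => hr.
  by apply: h; exists r.
have [r r0 hr] : exists2 r, 0 < r & forall v, u <= v < u + r -> Y v w <= Y u w + eps / 2.
  have [cr _] := Yc w; have /cvgrPdist_lt /(_ _ e20) := cr u u0.
  rewrite near_withinE => -[r /= r0 h]; exists r => // v /andP[uv vr].
  move: uv; rewrite le_eqVlt => /orP[/eqP<-|uv]; first by rewrite lerDl ltW.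
  have := h v; rewrite /= ltr0_norm ?subr_lt0// opprB ltrBlDl => /(_ vr uv).
  by rewrite ltr_norml => /andP[h1 h2]; lra.
near=> m.
rewrite ler0_norm ?subr_le0; last first.
  by apply: seq_min_ge => j jm; apply: running_inf_lb => //; exact: st.
rewrite opprB lerBlDl.
suff [j jm hj] : exists2 j, (j <= m.+1)%N & Y (s m j) w <= Y u w + eps / 2.
  by apply: le_trans (seq_min_le (fun j => Y (s m j) w) _ _ jm) _; lra.
have [u_0|u_0] := eqVneq u 0.
  by exists 0%N => //; rewrite /s mul0r -u_0; lra.
have up : 0 < u by rewrite lt_neqAle eq_sym u_0.
have tp : 0 < t by exact: lt_le_trans ut.
set delta := t / m.+1%:R; have d0 : 0 < delta by rewrite divr_gt0.
set k := Num.truncn (u / delta).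
have /andP[k1 k2] : k%:R <= u / delta < k.+1%:R.
  by apply: truncn_itv; rewrite divr_ge0// ltW.
rewrite ler_pdivlMr// in k1; rewrite ltr_pdivrMr// in k2.
have dr : delta < r.
  rewrite ltr_pdivrMr// -ltr_pdivrMl//; apply: lt_le_trans (_ : m%:R <= _); last first.
    by rewrite ler_nat.
  by rewrite mulrC; near: m; exact: nbhs_infty_gtr.
(* [k.+1] indexes the first grid point to the right of [u]. It leaves the grid only if [u = t], and
   then the last grid point is [u] itself. *)
have [km|mk] := leqP k.+1 m.+1.
  exists k.+1 => //; apply: hr; rewrite /s -/delta (ltW k2)/=.
  by rewrite -natr1 mulrDl mul1r ler_ltD.
have tu : t <= u.
  apply: le_trans k1; rewrite (_ : t = m.+1%:R * delta); last by rewrite mulrC divfK.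
  by rewrite ler_pM2r// ler_nat.
exists m.+1 => //; rewrite /s mulrC divfK//.
have -> : t = u by apply/eqP; rewrite eq_le tu ut.
by rewrite lerDl ltW.
Unshelve. all: by end_near. Qed.

Lemma measurable_Zref {n : nat} (X : 'I_n -> R -> Omega -> R) :
  (forall i s, measurable_fun setT (X i s)) ->
  (forall i w, cadlag (fun t => X i t w)) ->
  forall i t, 0 <= t -> measurable_fun setT (Zref X i t).
Proof.
move=> mX Xc i t t0; apply: measurable_funB.
  by apply: measurable_sum_cond => l _; exact: mX.
apply: (measurable_running_inf (fun t w => Ysum X i t w)) => // [s|w].
  by apply: measurable_sum_cond => l _; exact: mX.
by apply: cadlag_sum => l; exact: Xc.
Qed.

End MeasurableRunningInf.

Section ReflectedProcess.
Context {d} {Omega : measurableType d} {R : realType} (P : probability Omega R)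
  {n : nat} (X : 'I_n -> R -> Omega -> R) (phi : ('I_n -> R) -> R) (i0 : 'I_n).
Hypothesis inp : levy_input P X phi.
Hypothesis i00 : val i0 = 0%N.
Implicit Types (alpha : 'I_n -> R) (delta t : R).

Let Y i w t := Ysum X i t w.

Lemma ZrefE i t w : Zref X i t w = Y i w t - running_inf (Y i w) t.
Proof. by []. Qed.

Lemma cadlag_Ysum i w : cadlag (Y i w).
Proof. by apply: cadlag_sum => l; exact: (input_cadlag _ _ _ inp). Qed.

Lemma Ysum0 i w : Y i w 0 = 0.
Proof. by rewrite /Y /Ysum big1// => l _; exact: (input0 _ _ _ inp). Qed.

Lemma Ysum_increment_homo i i' w s t : (i <= i')%N -> 0 <= s -> s <= t ->
  Y i w t - Y i w s <= Y i' w t - Y i' w s.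
Proof.
move=> ii' s0 st.
pose x (l : 'I_n) (_ : nat) := X l t w - X l s w.
have x0 (l : 'I_n) j : (0 < l)%N -> 0 <= x l j.
  by move=> l0; rewrite subr_ge0; exact: (input_nondecreasing _ _ _ inp).
by have := step_sum_homo x x0 0 _ _ ii'; rewrite /step_sum /x !sumrB.
Qed.

(** Adding nondecreasing coordinates to the first one can only reduce drops. *)
Lemma Ysum_modulus i w T eta : 0 < eta ->
  exists2 d0, 0 < d0 & downward_modulus (Y i w) T d0 eta.
Proof.
move=> eta0; have jump := input_no_negative_jumps _ _ _ inp i0 i00 w.
have [d0 d00 h] := cadlag_downward_modulus _ T _ (input_cadlag _ _ _ inp i0 w) jump eta0.
exists d0 => //; apply: downward_modulus_le h => u v u0 uv.
have := Ysum_increment_homo 0 i w u v (leq0n i) u0 uv.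
have Y0 t : Y 0 w t = X i0 t w.
  by have := step_sum_first i0 i00 (fun l _ => X l t w) 0.
by rewrite !Y0.
Qed.

Lemma Zref_ge0 i t w : 0 <= t -> 0 <= Zref X i t w.
Proof.
by move=> t0; rewrite ZrefE subr_ge0; apply: running_inf_lb => //; exact: cadlag_Ysum.
Qed.

(** The reflected value is the supremum over [s <= t] of the increments of [Y i] from [s] to [t],
    and these increase with [i]. *)
Lemma Zref_homo t w : 0 <= t -> {homo (fun i => Zref X i t w) : i i' / (i <= i')%N >-> i <= i'}.
Proof.
move=> t0 i i' ii'; rewrite !ZrefE.
suff : running_inf (Y i' w) t - (Y i' w t - Y i w t) <= running_inf (Y i w) t by lra.
apply: running_inf_ge => // s s0 st.
have := running_inf_lb (Y i' w) t s (cadlag_Ysum i' w) s0 st.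
have := Ysum_increment_homo i i' w s t ii' s0 st; lra.
Qed.

Lemma Zref_lin_ge0 alpha t w : (forall k : nat, 0 <= tailn alpha k) -> 0 <= t ->
  0 <= \sum_i alpha i * Zref X i t w.
Proof.
move=> ta t0; have := tailn_sum_ge0 _ (fun i => Zref X i t w) ta
  (fun i => Zref_ge0 i t w t0) (Zref_homo t w t0) 0.
by rewrite (eq_bigl xpredT).
Qed.

Lemma Zref_lindley i delta w j : 0 < delta ->
  lindley (grid_increments X delta w) i j <= Zref X i (j%:R * delta) w /\
  (forall eta N, downward_modulus (Y i w) (N%:R * delta) delta eta -> (j <= N)%N ->
   Zref X i (j%:R * delta) w <= lindley (grid_increments X delta w) i j + eta).
Proof.
move=> d0; rewrite !ZrefE.
have YS k : Y i w (k.+1%:R * delta) =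
    Y i w (k%:R * delta) + step_sum (grid_increments X delta w) i k.
  by rewrite /Y /Ysum /step_sum /grid_increments /increments sumrB; ring.
have H N := lindley_reflection n (grid_increments X delta w) i (Y i w) delta N
  (cadlag_Ysum i w) d0 (Ysum0 i w) YS j.
split; first by have [] := H 0%N.
by move=> eta N hm jN; have [_] := H N; apply.
Qed.

Lemma measurable_Zref_input i t : 0 <= t -> measurable_fun setT (Zref X i t).
Proof.
exact: measurable_Zref (input_measurable _ _ _ inp) (input_cadlag _ _ _ inp) i t.
Qed.

(* Largest discrepancy between the reflected process and its discretization
   over the first N grid points. *)
Fixpoint lindley_gap delta N w : R :=
  if N is N'.+1 then Num.max (lindley_gap delta N' w)
    (\sum_(i < n) (Zref X i (N'%:R * delta) w - lindley (grid_increments X delta w) i N'))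
  else 0.

Lemma lindley_gap_ge0 delta N w : 0 <= lindley_gap delta N w.
Proof. by elim: N => //= N IH; rewrite le_max IH. Qed.

Lemma le_lindley_gap delta N w j : (j < N)%N ->
  \sum_(i < n) (Zref X i (j%:R * delta) w - lindley (grid_increments X delta w) i j)
  <= lindley_gap delta N w.
Proof.
elim: N => // N IH; rewrite ltnS leq_eqVlt => /orP[/eqP->|/IH h] /=.
  by rewrite le_max lexx orbT.
by rewrite le_max h.
Qed.

Lemma lindley_gap_le delta N w eta : 0 < delta -> 0 <= eta ->
  (forall i : 'I_n, downward_modulus (Y i w) (N%:R * delta) delta eta) ->
  lindley_gap delta N w <= n%:R * eta.
Proof.
move=> d0 eta0 h; suff : forall N', (N' <= N)%N -> lindley_gap delta N' w <= n%:R * eta.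
  by apply.
elim=> [_|N' IH N'N] /=; first by rewrite mulr_ge0.
rewrite ge_max IH/=; last exact: ltnW.
rewrite [leRHS]mulr_natl; apply: le_trans (_ : \sum_(i < n) eta <= _); last first.
  by rewrite sumr_const card_ord.
apply: ler_sum => i _; have [_ h2] := Zref_lindley i delta w N' d0.
by rewrite lerBlDl; apply: h2 (h i) _; exact: ltnW.
Qed.

Lemma measurable_lindley_gap delta N : 0 <= delta ->
  measurable_fun setT (lindley_gap delta N).
Proof.
move=> d0; elim: N => [|N IH] //=; apply: measurable_maxr => //.
apply: measurable_sum => i; apply: measurable_funB.
  by apply: measurable_Zref_input; rewrite mulr_ge0.
by apply: measurable_lindley => l k _; exact: (measurable_grid P X phi inp).
Qed.

(** Truncation at 1 supplies the dominating function, and loses nothing for the comparison of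
    exponentials with values in [0, 1]. *)
Definition mean_gap delta N : R := \int[P]_w Num.min 1 (lindley_gap delta N w).

Lemma mean_gap_cvg K : mean_gap (m%:R^-1) (K * m) @[m --> \oo] --> (0 : R).
Proof.
rewrite -[X in _ --> X](Rintegral_prob_cst P 0).
have mm m : measurable_fun setT (fun w => Num.min 1 (lindley_gap m%:R^-1 (K * m) w)).
  by apply: measurable_minr => //; apply: measurable_lindley_gap.
apply: (Rintegral_dominated P _ _ (fun _ => 1)) => //.
- move=> w; apply/cvgrPdist_le => eps eps0.
  have e0 : 0 < eps / (1 + n%:R) by rewrite divr_gt0// ltr_pwDl.
  have /all_sig2[dd dd0 h] (i : 'I_n) := cid2 (Ysum_modulus i w K%:R _ e0).
  near=> m.
  have m0 : (0 < m)%N by near: m; exact: nbhs_infty_gt.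
  rewrite sub0r normrN ger0_norm; last by rewrite le_min ler01 lindley_gap_ge0.
  rewrite ge_min; apply/orP; right.
  apply: le_trans (mulr_div1D_le n%:R eps (ler0n _ _) (ltW eps0)).
  apply: lindley_gap_le; rewrite ?invr_gt0 ?ltr0n//; first exact: ltW.
  move=> i; rewrite natrM mulfK ?pnatr_eq0 -?lt0n//.
  move=> u v u0 uv vt vu; apply: h => //; apply: le_trans vu _.
  rewrite invf_ple ?posrE ?ltr0n//.
  (* The sum of the inverses dominates each of them, so one threshold on [m] serves all
     coordinates. *)
  apply: le_trans (_ : \sum_i (dd i)^-1 <= _).
    by rewrite (bigD1 i)//= lerDl sumr_ge0// => l _; rewrite invr_ge0 ltW.
  by near: m; exact: nbhs_infty_ger.
- exact: cst_integrable.
- move=> m w; rewrite ger0_norm; last by rewrite le_min ler01 lindley_gap_ge0.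
  by rewrite ge_min lexx.
Unshelve. all: by end_near. Qed.

Definition mean_Zref_exp alpha t : R :=
  \int[P]_w expR (- \sum_i alpha i * Zref X i t w).

Lemma measurable_Zref_exp alpha t : 0 <= t ->
  measurable_fun setT (fun w => expR (- \sum_i alpha i * Zref X i t w)).
Proof.
move=> t0; apply: measurableT_comp => //; apply: measurable_funN.
apply: measurable_sum => i; apply: measurable_funM => //; exact: measurable_Zref_input.
Qed.

Lemma Zref_exp_le1 alpha t w : (forall k : nat, 0 <= tailn alpha k) -> 0 <= t ->
  expR (- \sum_i alpha i * Zref X i t w) <= 1.
Proof. by move=> ta t0; rewrite -expR0 ler_expR oppr_le0 Zref_lin_ge0. Qed.

Lemma mean_Zref_exp_bound alpha t : (forall k : nat, 0 <= tailn alpha k) -> 0 <= t ->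
  0 <= mean_Zref_exp alpha t <= 1.
Proof.
move=> ta t0; apply: Rintegral_le1 => [|w|w]; [exact: measurable_Zref_exp|exact: expR_ge0|].
exact: Zref_exp_le1.
Qed.

(** Both linear forms are nonnegative, where [expR (- x)] is 1-Lipschitz with values in [0, 1]. The
    difference is thus at most 1 and at most [A] times the gap, hence at most [1 + A] times the
    truncated gap. *)
Lemma mean_lindley_Zref alpha delta N j : (forall k : nat, 0 <= tailn alpha k) ->
  0 < delta -> (j < N)%N ->
  `|mean_lindley_exp P X delta alpha j - mean_Zref_exp alpha (j%:R * delta)| <=
  (1 + \sum_(i < n) `|alpha i|) * mean_gap delta N.
Proof.
move=> ta d0 jN; set A := \sum_(i < n) `|alpha i|; have A0 : 0 <= A by apply: sumr_ge0.
have t0 : 0 <= j%:R * delta by rewrite mulr_ge0// ltW.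
have i1 := integrable_lindley_exp P X phi inp _ (ltW d0) alpha ta j.
have i2 : P.-integrable setT
    (EFin \o (fun w => expR (- \sum_i alpha i * Zref X i (j%:R * delta) w))).
  apply: (bounded_Rintegrable P _ 1) => [|w]; first exact: measurable_Zref_exp.
  by rewrite ger0_norm ?expR_ge0// Zref_exp_le1.
have mg : measurable_fun setT (fun w => Num.min 1 (lindley_gap delta N w)).
  by apply: measurable_minr => //; apply: measurable_lindley_gap; exact: ltW.
have ig : P.-integrable setT (EFin \o (fun w => Num.min 1 (lindley_gap delta N w))).
  apply: (bounded_Rintegrable P _ 1) => // w; rewrite ger0_norm ?ge_min ?lexx//.
  by rewrite le_min ler01 lindley_gap_ge0.
rewrite /mean_lindley_exp /mean_Zref_exp -RintegralB//.
pose F w := lindley_exp (grid_increments X delta w) alpha j -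
  expR (- \sum_i alpha i * Zref X i (j%:R * delta) w).
have iF : P.-integrable setT (EFin \o F) by exact: (integrableB measurableT i1 i2).
apply: le_trans (le_normr_Rintegral measurableT iF) _.
rewrite /mean_gap -(RintegralZl _ measurableT ig); apply: le_Rintegral => //.
- exact: (integrable_norm iF).
- exact: (integrableZl measurableT _ ig).
move=> w _.
have gi0 (i : 'I_n) k := grid_increments_ge0 P X phi inp _ (ltW d0) w i k.
have a0 : 0 <= \sum_i alpha i * lindley (grid_increments X delta w) i j.
  have := lindley_exp_le1 _ gi0 alpha ta j.
  by rewrite /lindley_exp -[X in _ <= X -> _]expR0 ler_expR oppr_le0.
have b0 := Zref_lin_ge0 alpha _ w ta t0.
have g0 := lindley_gap_ge0 delta N w.
have F1 : `|F w| <= 1.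
  rewrite ler_norml /F.
  have := lindley_exp_le1 _ gi0 alpha ta j.
  have := lindley_exp_ge0 (grid_increments X delta w) alpha j.
  have := Zref_exp_le1 alpha _ w ta t0.
  have := expR_ge0 (- \sum_i alpha i * Zref X i (j%:R * delta) w); lra.
have FA : `|F w| <= A * lindley_gap delta N w.
  apply: le_trans (expRN_lipschitz _ _ a0 b0) _.
  rewrite -sumrB; apply: le_trans (ler_norm_sum _ _ _) _.
  apply: le_trans (_ : \sum_(i < n) A * (Zref X i (j%:R * delta) w -
      lindley (grid_increments X delta w) i j) <= _); last first.
    by rewrite -mulr_sumr ler_wpM2l//; exact: le_lindley_gap.
  apply: ler_sum => i _; rewrite -mulrBr normrM.
  have [h _] := Zref_lindley i delta w j d0.
  rewrite distrC (ger0_norm (x := _ - _)) ?subr_ge0//.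
  apply: ler_wpM2r; first by rewrite subr_ge0.
  by rewrite /A (bigD1 i)//= lerDl sumr_ge0.
have [h|h] := leP 1 (lindley_gap delta N w).
  by apply: le_trans F1 _; rewrite mulr1 lerDl.
by apply: le_trans FA _; rewrite ler_wpM2r// lerDr.
Qed.

(** A Cesaro argument: the cells before a fixed time [T0] have share [T0 / K], later ones see a
    transform of [Z] close to [L], and the recursion differs from it by a multiple of the mean
    gap. *)
Lemma avg_lindley_cvg alpha (mK : nat -> nat) L : (forall k : nat, 0 <= tailn alpha k) ->
  (forall K, (0 < mK K)%N) ->
  mean_gap ((mK K)%:R^-1) (K * mK K) @[K --> \oo] --> (0 : R) ->
  mean_Zref_exp alpha t @[t --> +oo] --> L -> 0 <= L -> L <= 1 ->
  avg_lindley P X alpha K (mK K) @[K --> \oo] --> L.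
Proof.
move=> ta mK0 gap0 ZL L0 L1; apply/cvgrPdist_le => eps eps0.
set A := \sum_(i < n) `|alpha i|; have A0 : 0 <= A by apply: sumr_ge0.
have e30 : 0 < eps / 3 by rewrite divr_gt0.
have e40 : 0 < eps / 3 / (1 + (1 + A)) by rewrite divr_gt0// addr_gt0// ltr_pwDl.
have /cvgrPdist_le /(_ _ e30) [T [_ hT]] := ZL.
pose T0 := (Num.truncn (Num.max 0 T)).+1.
have T0T t : T0%:R <= t -> T < t.
  move=> h; apply: lt_le_trans h; apply: le_lt_trans (_ : Num.max 0 T < _).
    by rewrite le_max lexx orbT.
  by apply: truncnS_gt.
near=> K.
have K0 : (0 < K)%N by near: K; exact: nbhs_infty_gt.
have KR : 0 < K%:R :> R by rewrite ltr0n.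
have gK : `|0 - mean_gap ((mK K)%:R^-1) (K * mK K)| <= eps / 3 / (1 + (1 + A)).
  by near: K; move/cvgrPdist_le : gap0; apply.
have TK : T0%:R / K%:R <= eps / 3.
  rewrite ler_pdivrMr// mulrC -ler_pdivrMr//; near: K; exact: nbhs_infty_ger.
set m := mK K; have m0 : (0 < m)%N by exact: mK0.
have mR : 0 < m%:R :> R by rewrite ltr0n.
set delta : R := m%:R^-1 in gK *.
have d0 : 0 < delta by rewrite invr_gt0.
set N := (K * m)%N in gK *; have N0 : 0 < N%:R :> R by rewrite ltr0n muln_gt0 K0.
have gap_le : (1 + A) * mean_gap delta N <= eps / 3.
  have A1 : 0 <= 1 + A by rewrite addr_ge0.
  apply: le_trans (mulr_div1D_le _ _ A1 (ltW e30)); apply: ler_wpM2l => //.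
  by apply: le_trans (ler_norm _) _; rewrite -normrN -sub0r.
have -> : L - avg_lindley P X alpha K m =
    (\sum_(j < N) (L - mean_lindley_exp P X delta alpha j)) / N%:R.
  by rewrite sumrB sumr_const card_ord mulrBl -[L *+ N]mulr_natr mulfK ?gt_eqF.
rewrite normrM [`|N%:R^-1|]gtr0_norm ?invr_gt0// ler_pdivrMr//.
apply: le_trans (ler_norm_sum _ _ _) _.
apply: le_trans (_ : \sum_(j < N) ((j < T0 * m)%:R + (eps / 3 + eps / 3)) <= _).
  apply: ler_sum => j _.
  have t0 : 0 <= j%:R * delta by rewrite mulr_ge0// ltW.
  have h1 := mean_lindley_Zref alpha delta N j ta d0 (ltn_ord j).
  have h2 : `|L - mean_Zref_exp alpha (j%:R * delta)| <= (j < T0 * m)%:R + eps / 3.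
    case: ltnP => jT.
      have /andP[z0 z1] := mean_Zref_exp_bound alpha _ ta t0.
      by rewrite (_ : true%:R = 1 :> R)// ler_norml; lra.
    rewrite (_ : false%:R = 0 :> R)// add0r; apply: hT; apply: T0T.
    by rewrite ler_pdivlMr// -natrM ler_nat.
  rewrite distrC -(subrK (mean_Zref_exp alpha (j%:R * delta)) (mean_lindley_exp _ _ _ _ _)).
  rewrite -addrA; apply: le_trans (ler_normD _ _) _.
  rewrite [leRHS]addrCA; apply: lerD; first exact: le_trans h1 gap_le.
  by rewrite distrC.
rewrite big_split/= sumr_const card_ord -[_ *+ N]mulr_natr.
apply: le_trans (_ : (T0 * m)%:R + (eps / 3 + eps / 3) * N%:R <= _).
  by rewrite lerD2r; exact: sum_ltn_le.
have -> : (T0 * m)%:R = T0%:R / K%:R * N%:R :> R.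
  by rewrite /N !natrM mulrA divfK ?gt_eqF.
have -> : eps * N%:R = eps / 3 * N%:R + (eps / 3 + eps / 3) * N%:R.
  by rewrite -mulrDl; congr (_ * _); lra.
by rewrite lerD2r ler_pM2r.
Unshelve. all: by end_near. Qed.

End ReflectedProcess.

(** * The steady state seen through linear forms *)

Section LinearSteadyState.
Context {d} {Omega : measurableType d} {R : realType} (P : probability Omega R)
  {n : nat}.

(* Weak convergence tested only on functions of one linear form, whose
   measurability needs no Borel structure on vectors. *)
Definition linear_steady_state (X : 'I_n -> R -> Omega -> R) (Zs : 'I_n -> Omega -> R) :=
  forall (alpha : 'I_n -> R) (G : R -> R) M, continuous G -> (forall x, `|G x| <= M) ->
  (\int[P]_w (G (\sum_i alpha i * Zref X i t w))%:E)%E @[t --> +oo] -->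
  (\int[P]_w (G (\sum_i alpha i * Zs i w))%:E)%E.

Lemma steady_state_linear X Zs : steady_state P X Zs -> linear_steady_state X Zs.
Proof.
move=> ssZ alpha G M Gc GM.
pose lin (v : 'rV[R]_n) : R := \sum_i alpha i * v 0 i.
have linc : continuous lin.
  move=> v.
  have H i : alpha i * (u : 'rV[R]_n) 0 i @[u --> v] --> alpha i * v 0 i.
    apply: (@cvgM _ _ (nbhs v) _ (cst (alpha i)) (fun u : 'rV[R]_n => u 0 i)).
      exact: cvg_cst.
    exact: coord_continuous.
  exact: (cvg_big_sum (F := nbhs v) _ (fun i (u : 'rV[R]_n) => alpha i * u 0 i) _ H).
have gc : continuous (G \o lin).
  by move=> v; apply: continuous_comp; [exact: linc|exact: Gc].
have rowE (V : 'I_n -> R) : lin (\row_i V i) = \sum_i alpha i * V i.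
  by rewrite /lin; apply: eq_bigr => i _; rewrite mxE.
have := ssZ (G \o lin) gc (ex_intro _ M (fun v => GM (lin v))).
under eq_integral => w _ do rewrite /= rowE.
have -> : (fun t => \int[P]_w ((G \o lin) (\row_i Zref X i t w))%:E)%E =
    (fun t => \int[P]_w (G (\sum_i alpha i * Zref X i t w))%:E)%E.
  by apply/funext => t; apply: eq_integral => w _; rewrite /= rowE.
by [].
Qed.

End LinearSteadyState.

Section SteadyState.
Context {d} {Omega : measurableType d} {R : realType} (P : probability Omega R)
  {n : nat} (X : 'I_n -> R -> Omega -> R) (phi : ('I_n -> R) -> R)
  (Zs : 'I_n -> Omega -> R).
Hypothesis inp : levy_input P X phi.
Hypothesis mZs : forall i, measurable_fun setT (Zs i).
Hypothesis ssZ : linear_steady_state P X Zs.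

Let linZs (alpha : 'I_n -> R) w := \sum_i alpha i * Zs i w.

Let measurable_linZs alpha : measurable_fun setT (linZs alpha).
Proof. by apply: measurable_sum => i; apply: measurable_funM. Qed.

Let continuous_max0 : continuous (fun x : R => Num.max 0 x).
Proof.
by move=> x; exact: (continuous_max (f := cst 0) (g := id) (cvg_cst _) cvg_id).
Qed.

Lemma steady_state_Rintegral (alpha : 'I_n -> R) (G : R -> R) M : continuous G ->
  (forall x, `|G x| <= M) ->
  \int[P]_w G (\sum_i alpha i * Zref X i t w) @[t --> +oo] -->
  \int[P]_w G (linZs alpha w).
Proof.
move=> Gc GM; have := ssZ alpha G M Gc GM.
rewrite (EFin_Rintegral P); first exact: fine_cvg.
apply: (bounded_Rintegrable P _ M) => [|w]; last exact: GM.
exact: (measurableT_comp (continuous_measurable_fun Gc) (measurable_linZs alpha)).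
Qed.

(** The cutoff at 0 makes the test function bounded. It is invisible for the reflected process,
    whose linear forms are nonnegative, and is removed for [Zs] in [steady_state_laplace]. *)
Definition stationary_laplace (alpha : 'I_n -> R) : R :=
  \int[P]_w expR (- Num.max 0 (\sum_i alpha i * Zs i w)).

Let measurable_exp_linZs alpha :
  measurable_fun setT (fun w => expR (- Num.max 0 (linZs alpha w))).
Proof.
by apply: measurableT_comp => //; apply: measurable_funN; exact: measurable_maxr.
Qed.

Let exp_max0_le1 (x : R) : `|expR (- Num.max 0 x)| <= 1.
Proof. by rewrite ger0_norm ?expR_ge0// -expR0 ler_expR oppr_le0 le_max lexx. Qed.

Lemma stationary_laplace_bound alpha : 0 <= stationary_laplace alpha <= 1.
Proof.
apply: Rintegral_le1 => [|w|w]; [exact: measurable_exp_linZs|exact: expR_ge0|].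
exact: le_trans (ler_norm _) (exp_max0_le1 _).
Qed.

Lemma mean_Zref_exp_cvg alpha : (forall k : nat, 0 <= tailn alpha k) ->
  mean_Zref_exp P X alpha t @[t --> +oo] --> stationary_laplace alpha.
Proof.
move=> ta; pose G (x : R) := expR (- Num.max 0 x).
have Gc : continuous G.
  move=> x; have lc : - Num.max 0 y @[y --> x] --> - Num.max 0 x.
    exact: (cvgN (continuous_max0 x)).
  exact: (cvg_comp _ _ lc (@continuous_expR R _)).
move: (steady_state_Rintegral alpha G 1 Gc exp_max0_le1).
apply: cvg_trans; apply: near_eq_cvg; near=> t.
have t0 : 0 <= t by near: t; exact: nbhs_pinfty_ge.
rewrite /mean_Zref_exp; apply: eq_Rintegral => w _.
by rewrite /G max_r// (Zref_lin_ge0 P X phi inp).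
Unshelve. all: by end_near. Qed.

(** The bounded continuous function [Num.min 1 (Num.max 0 (- x))] vanishes on the linear forms of
    the reflected process, so its mean under the limit law is 0. *)
Lemma steady_state_lin_ge0 alpha : (forall k : nat, 0 <= tailn alpha k) ->
  {ae P, forall w, 0 <= linZs alpha w}.
Proof.
move=> ta; pose G (x : R) := Num.min 1 (Num.max 0 (- x)).
have Gc : continuous G.
  move=> x; have lc : Num.max 0 (- y) @[y --> x] --> Num.max 0 (- x).
    exact: (cvg_comp _ _ (cvgN cvg_id) (continuous_max0 _)).
  exact: (continuous_min (f := cst 1) (cvg_cst _) lc).
have G0 x : 0 <= G x by rewrite le_min ler01 le_max lexx.
have G1 x : `|G x| <= 1 by rewrite ger0_norm// ge_min lexx.
have mG : measurable_fun setT (fun w => G (linZs alpha w)).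
  by apply: measurableT_comp => //; exact: continuous_measurable_fun.
have E0 : \int[P]_w G (linZs alpha w) = 0.
  have h := steady_state_Rintegral alpha G 1 Gc G1; apply: (cvg_unique _ h) => //.
  apply: cvg_near_cst; near=> t.
  have t0 : 0 <= t by near: t; exact: nbhs_pinfty_ge.
  rewrite -[RHS](Rintegral_prob_cst P); apply: eq_Rintegral => w _.
  by rewrite /G max_l ?min_r// oppr_le0; exact: (Zref_lin_ge0 P X phi inp).
have iG : P.-integrable setT (EFin \o (fun w => G (linZs alpha w))).
  by apply: (bounded_Rintegrable P _ 1).
apply: filterS (Rintegral_gt0_ae P _ mG (fun w => G0 _) E0 iG) => w.
rewrite /G => h; rewrite leNgt; apply/negP => l0; move: h.
rewrite max_r ?oppr_ge0 ?ltW// /Num.min; case: ifP => _ h; last by lra.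
by move: (@ltr01 R); rewrite h ltxx.
Unshelve. all: by end_near. Qed.

Lemma steady_state_laplace alpha : (forall k : nat, 0 <= tailn alpha k) ->
  (\int[P]_w (expR (- \sum_i alpha i * Zs i w))%:E = (stationary_laplace alpha)%:E)%E.
Proof.
move=> ta.
have iZ : P.-integrable setT (EFin \o (fun w => expR (- Num.max 0 (linZs alpha w)))).
  apply: (bounded_Rintegrable P _ 1) => [|w]; [exact: measurable_exp_linZs|exact: exp_max0_le1].
rewrite -(EFin_Rintegral P _ iZ); apply: ae_eq_integral => //.
- apply/measurable_EFinP; apply: measurableT_comp => //; apply: measurable_funN.
  exact: measurable_linZs.
- exact/measurable_EFinP/measurable_exp_linZs.
- apply: filterS (steady_state_lin_ge0 alpha ta) => w h _ /=.
  by rewrite max_r.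
Qed.

End SteadyState.

(** * The root psi *)

Section Root.
Context {d} {Omega : measurableType d} {R : realType} (P : probability Omega R)
  {n : nat} (X : 'I_n -> R -> Omega -> R) (phi : ('I_n -> R) -> R).
Hypothesis inp : levy_input P X phi.
Hypothesis n1 : (0 < n)%N.
Hypothesis mean_neg : (\int[P]_w (Ysum X n.-1 1 w)%:E < 0)%E.

Let mX := input_measurable _ _ _ inp.

Lemma input_ge0 (i : 'I_n) t w : (0 < i)%N -> 0 <= t -> 0 <= X i t w.
Proof.
by move=> i0 t0; rewrite -(input0 _ _ _ inp i w); apply: (input_nondecreasing _ _ _ inp).
Qed.

Lemma Ysum_last t w : Ysum X n.-1 t w = \sum_i X i t w.
Proof. by rewrite /Ysum; apply: eq_bigl => j; rewrite -ltnS prednK// ltn_ord. Qed.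

Let mYlast : measurable_fun setT (fun w => \sum_i X i 1 w).
Proof. by apply: measurable_sum => i; exact: mX. Qed.

Lemma mean_Ysum_neg : ~ {ae P, forall w, 0 <= \sum_i X i 1 w}.
Proof.
move=> h; move: mean_neg; apply/negP; rewrite -leNgt.
rewrite (_ : (\int[P]_w (Ysum X n.-1 1 w)%:E =
  \int[P]_w (Num.max 0 (\sum_i X i 1 w))%:E)%E).
  by apply: integral_ge0 => w _; rewrite lee_fin le_max lexx.
under eq_integral => w _ do rewrite Ysum_last.
apply: ae_eq_integral => //; first exact/measurable_EFinP.
- by apply/measurable_EFinP; exact: measurable_maxr.
- by apply: filterS h => w hw _ /=; rewrite max_r.
Qed.

Context (k : nat) (gamma : 'I_n -> R).
Hypothesis k0 : (0 < k)%N.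
Hypothesis g0 : forall i : 'I_n, (k <= i)%N -> 0 <= gamma i.

Let point (b : R) : 'I_n -> R := fun i => if (i < k)%N then b else gamma i.

Let head w := \sum_(i < n | (i < k)%N) X i 1 w.
Let tail w := \sum_(i < n | ~~ (i < k)%N) gamma i * X i 1 w.

Let point_ge0 b i : 0 <= b -> 0 <= point b i.
Proof. by rewrite /point; case: ltnP => // ki _; exact: g0. Qed.

Let point_sum b w : \sum_i point b i * X i 1 w = b * head w + tail w.
Proof.
rewrite (bigID (fun i : 'I_n => (i < k)%N))/= mulr_sumr; congr (_ + _).
  by apply: eq_bigr => i ik; rewrite /point ik.
by apply: eq_bigr => i ik; rewrite /point (negbTE ik).
Qed.

Let mhead : measurable_fun setT head.
Proof. by apply: measurable_sum_cond => i _; exact: mX. Qed.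

Let mtail : measurable_fun setT tail.
Proof. by apply: measurable_sum_cond => i _; apply: measurable_funM => //; exact: mX. Qed.

Let laplace_point b : 0 <= b ->
  P.-integrable setT (EFin \o (fun w => expR (- (b * head w + tail w)))) /\
  \int[P]_w expR (- (b * head w + tail w)) = expR (phi (point b)).
Proof.
move=> b0; have := laplace_input P X phi inp (point b) 1 (fun i => point_ge0 b i b0) ler01.
by rewrite mulr1; under [fun w => expR _]funext => w do rewrite point_sum.
Qed.

(** If the exponent were nonnegative, an exponential bounded by 1 would have mean at least 1, hence
    equal 1 almost surely; every nonnegative term of its exponent, in particular that of [i1], would
    then vanish at all times. *)
Lemma phi_point0_lt0 (i1 : 'I_n) : (k <= i1)%N -> gamma i1 != 0 ->
  ~ identically_zero_coord P X i1 -> phi (point 0) < 0.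
Proof.
move=> ki1 gi1 nz; rewrite ltNge; apply/negP => ph0; apply: nz => t t0.
have [iE E] := laplace_input P X phi inp (point 0) t (fun i => point_ge0 0 i (lexx 0)) t0.
set s := (fun w => expR _) in iE E.
have term0 w (i : 'I_n) : 0 <= point 0 i * X i t w.
  rewrite /point; case: ltnP => ki; first by rewrite mul0r.
  by apply: mulr_ge0; [exact: g0|apply: input_ge0 => //; exact: leq_trans k0 ki].
have s1 w : s w <= 1.
  by rewrite /s -expR0 ler_expR oppr_le0; apply: sumr_ge0 => i _; exact: term0.
have ms : measurable_fun setT s by have /integrableP[/measurable_EFinP] := iE.
have i1s : P.-integrable setT (EFin \o (fun w => 1 - s w)).
  exact: (integrableB measurableT (cst_integrable P 1) iE).
have E1s : \int[P]_w (1 - s w) = 0.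
  apply/eqP; rewrite eq_le; apply/andP; split; last first.
    by apply: Rintegral_ge0 => w _; rewrite subr_ge0.
  rewrite RintegralB//; last exact: cst_integrable.
  by rewrite Rintegral_prob_cst E subr_le0 -expR0 ler_expR mulr_ge0.
have m1s : measurable_fun setT (fun w => 1 - s w) by exact: measurable_funB.
have p1s w : 0 <= 1 - s w by rewrite subr_ge0.
apply: filterS (Rintegral_gt0_ae P _ m1s p1s E1s i1s) => w /eqP.
rewrite subr_eq0 eq_sym -[X in _ == X]expR0 => /eqP /expR_inj /eqP.
rewrite oppr_eq0 psumr_eq0; last by move=> i _; exact: term0.
move=> /allP /(_ i1 (mem_index_enum _)) /=.
by rewrite /point ltnNge ki1/= mulf_eq0 (negbTE gi1)/= => /eqP.
Qed.

(** The transform at [b] is at least [b] times the mean of [neg], the negative part of [head]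
    weighted by [expR (- tail w)]. If it stayed below 1 for all [b > 0], [head] would be nonnegative
    almost surely, and so would the total sum, against the negative mean. *)
Lemma phi_point_gt0 : exists2 b, 0 < b & 0 < phi (point b).
Proof.
apply: contrapT => h.
have phle b : 0 < b -> phi (point b) <= 0.
  by move=> b0; rewrite leNgt; apply/negP => hb; apply: h; exists b.
pose neg w := expR (- tail w) * Num.max 0 (- head w).
have neg0 w : 0 <= neg w by rewrite mulr_ge0 ?expR_ge0// le_max lexx.
have mneg : measurable_fun setT neg.
  apply: measurable_funM; first by apply: measurableT_comp => //; exact: measurable_funN.
  by apply: measurable_maxr => //; exact: measurable_funN.
have negb b w : 0 <= b -> b * neg w <= expR (- (b * head w + tail w)).
  move=> b0; rewrite opprD addrC expRD /neg mulrCA ler_wpM2l ?expR_ge0//.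
  have := expR_ge1Dx (- (b * head w)); have := expR_ge0 (- (b * head w)).
  by have [_|_] := leP 0 (- head w); rewrite ?mulr0// mulrN; lra.
have [i1 _] := laplace_point 1 ler01.
have ineg : P.-integrable setT (EFin \o neg).
  apply: (le_Rintegrable _ _ _ mneg _ i1) => w; rewrite ger0_norm//.
  by have := negb 1 w ler01; rewrite mul1r.
have c0 : \int[P]_w neg w = 0.
  apply/eqP; rewrite eq_le Rintegral_ge0// andbT leNgt; apply/negP => cp.
  set c := \int[P]_w neg w in cp.
  (* This [b] raises the lower bound to 2, above the assumed bound 1. *)
  have b0 : 0 < 2 / c by rewrite divr_gt0.
  have [ib Eb] := laplace_point _ (ltW b0).
  have : 2 / c * c <= expR (phi (point (2 / c))).
    rewrite -Eb -(RintegralZl _ measurableT ineg); apply: le_Rintegral => //.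
    - exact: (integrableZl measurableT _ ineg).
    - by move=> w _; apply: negb; exact: ltW.
  rewrite divfK ?gt_eqF//.
  have : expR (phi (point (2 / c))) <= 1 by rewrite -[leRHS]expR0 ler_expR; exact: phle.
  lra.
apply: mean_Ysum_neg; apply: filterS (Rintegral_gt0_ae P _ mneg neg0 c0 ineg) => w.
move/eqP; rewrite mulf_eq0 gt_eqF ?expR_gt0//= => /eqP hm.
have hw : 0 <= head w.
  by rewrite -oppr_le0 -[leRHS]hm le_max lexx orbT.
rewrite (bigID (fun i : 'I_n => (i < k)%N))/= addr_ge0//.
apply: sumr_ge0 => i; rewrite -leqNgt => ki; apply: input_ge0 => //.
exact: leq_trans k0 ki.
Qed.

(** The intermediate value theorem is applied at level 1 to the transform [M], not to [phi]:
    continuity of a mean comes from domination, and [phi] is known only through its exponential. *)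
Lemma phi_point_root (i1 : 'I_n) : (k <= i1)%N -> gamma i1 != 0 ->
  ~ identically_zero_coord P X i1 -> exists b, 0 < b /\ phi (point b) = 0.
Proof.
move=> ki1 gi1 nz; have neg := phi_point0_lt0 i1 ki1 gi1 nz.
have [B B0 pos] := phi_point_gt0.
(* [Num.max 0 b] extends the family to negative [b], so that an open interval surrounds [0, B]. *)
pose f (b : R) w := expR (- (Num.max 0 b * head w + tail w)).
pose M b := \int[P]_w f b w.
have mx0 (b : R) : 0 <= Num.max 0 b by rewrite le_max lexx.
have ME b : M b = expR (phi (point (Num.max 0 b))).
  by have [_] := laplace_point _ (mx0 b).
have i_f b : P.-integrable setT (EFin \o f b) by have [] := laplace_point _ (mx0 b).
pose B1 := B + 1.
have B10 : 0 <= B1 by rewrite /B1; lra.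
(* The exponent is affine in the parameter, so one of its two end values dominates, depending on the
   sign of [head w]. *)
pose g w := expR (- (0 * head w + tail w)) + expR (- (B1 * head w + tail w)).
have ig : P.-integrable setT (EFin \o g).
  have [j1 _] := laplace_point 0 (lexx 0); have [j2 _] := laplace_point B1 B10.
  exact: (integrableD measurableT j1 j2).
have cM : {in `](-1 : R), B1[%classic, continuous M}.
  apply: (@continuity_under_integral R d Omega P f setT measurableT (-1) B1 _ _ g ig).
  - by move=> b _; exact: i_f.
  - apply: aeW => w _ b _.
    have mc : {for b, continuous (fun b : R => Num.max 0 b)}.
      exact: (continuous_max (f := cst 0) (g := id) (x := b) (cvg_cst _) cvg_id).
    have lc : (- (Num.max 0 c * head w + tail w)) @[c --> b] -->
        - (Num.max 0 b * head w + tail w).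
      exact: (cvgN (cvgD (cvgM mc (cvg_cst (head w))) (cvg_cst (tail w)))).
    exact: (cvg_comp _ _ lc (@continuous_expR R _)).
  - move=> b; rewrite /= in_itv/= => /andP[_ bB]; apply: aeW => w _.
    rewrite ger0_norm ?expR_ge0// /g /f.
    have mB : Num.max 0 b <= B1 by rewrite ge_max B10 ltW.
    have [hw|hw] := leP 0 (head w).
      rewrite ler_wpDr ?expR_ge0// ler_expR lerN2 lerD2r mul0r.
      by apply: mulr_ge0.
    rewrite ler_wpDl ?expR_ge0// ler_expR lerN2 lerD2r.
    by rewrite ler_wnM2r// ltW.
have cM' : {within `[0, B], continuous M}.
  apply: continuous_in_subspaceT => b; rewrite inE/= in_itv/= => /andP[b0 bB].
  by apply: cM; rewrite inE/= in_itv/= /B1; apply/andP; split; lra.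
have M0 : M 0 < 1 by rewrite ME maxxx -expR0 ltr_expR.
have MB : 1 < M B by rewrite ME (max_r (ltW B0)) -expR0 ltr_expR.
have [|c /[!in_itv]/= /andP[c0 cB] Mc] := IVT (ltW B0) cM' (v := 1).
  by apply/andP; split; [rewrite ge_min (ltW M0)|rewrite le_max (ltW MB) orbT].
have cp : 0 < c.
  rewrite lt_neqAle c0 andbT; apply/eqP => c_0.
  by move: M0; rewrite -c_0 in Mc; rewrite Mc ltxx.
exists c; split => //; move: Mc; rewrite ME max_r// -[X in _ = X]expR0.
exact: expR_inj.
Qed.

Lemma psiP : (forall i : 'I_n, (0 < i)%N -> ~ identically_zero_coord P X i) ->
  0 <= psi phi k gamma /\
  phi (fun i => if (i < k)%N then psi phi k gamma else gamma i) = 0.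
Proof.
move=> nz; rewrite /psi; case: asboolP => [z|nzg].
  split=> //; rewrite -[RHS](input_phi0 P X phi inp); congr phi; apply/funext => i.
  by case: ltnP => // /z.
have [i1 [ki1 gi1]] : exists i : 'I_n, (k <= i)%N /\ gamma i != 0.
  apply: contrapT => h; apply: nzg => i ki; apply/eqP; apply/negPn/negP => gi.
  by apply: h; exists i.
have [b Pb] := phi_point_root i1 ki1 gi1 (nz i1 (leq_trans k0 ki1)).
have [h1 h2] := xgetPex 0 (ex_intro (fun b => 0 < b /\ phi (point b) = 0) b Pb).
by split; [exact: ltW|exact: h2].
Qed.

End Root.

(** * Limiting pushing rates *)

Section RecursionSum.
Context {R : realType} {n : nat} (phi : ('I_n -> R) -> R) (c : R) (alpha : 'I_n -> R).

Lemma av_ord (i : 'I_n) : av alpha i = alpha i.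
Proof. by rewrite /av valK. Qed.

(** Merges f_1, ..., f_{n-1} and the constant f_n into one family indexed from 0, so that numerators
    and right-hand side become plain sums over coordinates. *)
Definition flow (p : nat) : R := if (p.+1 < n)%N then fk phi c alpha p.+1 else c.

Lemma fnumE k : (k <= n)%N ->
  fnum phi c alpha (n - k) = \sum_(l < n | (k <= l)%N) alpha l * flow l.
Proof.
move=> kn; have [e] := ubnP (n - k)%N; elim: e k kn => // e IH k kn ke.
move: kn; rewrite leq_eqVlt => /orP[/eqP ->|kn].
  by rewrite subnn sum_ord_ge_oversize.
pose k' := Ordinal kn.
have kE : (n - k = (n - k.+1).+1)%N by rewrite subnS prednK// subn_gt0.
rewrite (sum_ord_geS _ k') kE /=.
have aE p : p = k -> av alpha p = alpha k' by move=> ->; rewrite (av_ord k').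
have [/eqP h|h] := eqVneq (n - k.+1)%N 0%N.
  have kl : (n <= k.+1)%N by rewrite -subn_eq0.
  rewrite sum_ord_ge_oversize// addr0 /flow /= ltnNge kl /= aE//.
  by apply/eqP; rewrite -eqSS prednK ?(leq_ltn_trans _ kn)// eqn_leq kl kn.
have kl : (k.+1 < n)%N by rewrite ltnNge -subn_eq0.
have dE : (n - (n - k.+1) = k.+1)%N by rewrite subKn// ltnW.
rewrite dE /= (aE k)// /flow /= kl -IH//; last by rewrite -ltnS -kE.
Qed.

Lemma rhsE : (0 < n)%N -> rhs phi c alpha = \sum_(l < n) alpha l * flow l.
Proof.
move=> n0; rewrite /rhs.
have split_last (F : nat -> R) m :
    \sum_(0 <= p < m.+1) F p = \sum_(1 <= k < m.+1) F k.-1 + F m.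
  by rewrite big_nat_recr//= big_add1.
have -> : \sum_(l < n) alpha l * flow l = \sum_(0 <= p < n) av alpha p * flow p.
  by rewrite big_mkord; apply: eq_bigr => l _; rewrite av_ord.
have := split_last (fun p => av alpha p * flow p) n.-1; rewrite prednK// => ->.
congr (_ + _ * _); last by rewrite /flow prednK// ltnn.
by apply: eq_big_nat => k /andP[k0 kn]; rewrite /flow prednK// kn.
Qed.

End RecursionSum.

Section LimitRates.
Context {R : realType}.

(** Domination uniform in [b]. For negative [y] the quotient is at most [- y * expR (- y)], and
    [- y <= expR (- y)] gives the factor 2 in the exponent. *)
Lemma diff_quotient_bound (b y : R) : 0 < b -> b <= 1 ->
  `|(expR (- (b * y)) - 1) / b| <= `|y| + expR (- (2 * y)).
Proof.
move=> b0 b1; rewrite normrM [`|b^-1|]gtr0_norm ?invr_gt0// ler_pdivrMr//.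
have [y0|y0] := leP 0 y.
  have h := expR_ge1Dx (- (b * y)).
  have e1 : expR (- (b * y)) <= 1 by rewrite -[leRHS]expR0 ler_expR oppr_le0 mulr_ge0// ltW.
  rewrite ler0_norm ?subr_le0// (ger0_norm y0) mulrDl.
  have : 0 <= expR (- (2 * y)) * b by rewrite mulr_ge0 ?expR_ge0// ltW.
  by rewrite mulrC; lra.
have z0 : 0 < - y by lra.
have h1 := expR_sub1_le (- (b * y)).
have e1 : 1 <= expR (- (b * y)) by rewrite -expR0 ler_expR -mulrN mulr_ge0 ?ltW.
rewrite ger0_norm ?subr_ge0//; apply: le_trans h1 _.
rewrite -mulrN -mulrA mulrC; apply: ler_wpM2r; first exact: ltW.
apply: le_trans (_ : expR (- y) * expR (- y) <= _).
  apply: ler_pM; rewrite ?expR_ge0 ?(ltW z0)//.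
    by have := expR_ge1Dx (- y); lra.
  by rewrite ler_expR ler_piMl// ltW.
by rewrite -expRD (_ : - y + - y = - (2 * y)) ?lerDr//; ring.
Qed.

Lemma diff_quotient_cvg (y : R) :
  (expR (- (m.+1%:R^-1 * y)) - 1) / m.+1%:R^-1 @[m --> \oo] --> - y.
Proof.
apply/cvgrPdist_le => eps eps0; near=> m.
have D_le : y ^+ 2 * expR `|y| * m.+1%:R^-1 <= eps.
  rewrite ler_pdivrMr// -ler_pdivrMl//.
  apply: le_trans (_ : (m%:R : R) <= _); last by rewrite ler_nat.
  by near: m; exact: nbhs_infty_ger.
set b : R := m.+1%:R^-1 in D_le *; have b0 : 0 < b by rewrite invr_gt0.
have b1 : b <= 1 by rewrite invf_le1// ler1n.
have := expR_taylor2_scale (- y) b (ltW b0) b1.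
rewrite (_ : - y * b = - (b * y)); last by rewrite mulNr mulrC.
rewrite sqrrN normrN => h.
rewrite (_ : - y - _ = - (expR (- (b * y)) - 1 - - (b * y)) / b); last first.
  by field; rewrite gt_eqF.
rewrite normrM normrN [`|b^-1|]gtr0_norm ?invr_gt0// ler_pdivrMr//.
apply: le_trans h _; move: D_le; move: (y ^+ 2 * expR `|y|) => D D_le.
rewrite (_ : b ^+ 2 * D = D * b * b); last by ring.
by rewrite ler_pM2r.
Unshelve. all: by end_near. Qed.

(* From x <= e^x - 1 and 1 - e^(-x) <= x. *)
Lemma exponent_quotient_cvg (kappa : nat -> R) (l : R) :
  (expR (kappa m) - 1) / m.+1%:R^-1 @[m --> \oo] --> l ->
  kappa m / m.+1%:R^-1 @[m --> \oo] --> l.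
Proof.
move=> h; pose q m : R := (expR (kappa m) - 1) / m.+1%:R^-1.
have b0 m : 0 < (m.+1%:R^-1 : R) by rewrite invr_gt0.
have ek : expR (kappa m) @[m --> \oo] --> (1 : R).
  have -> : (fun m => expR (kappa m)) = (fun m => 1 + q m * m.+1%:R^-1).
    by apply/funext => m; rewrite /q divfK ?gt_eqF// addrC subrK.
  have h1 := cvgD (cvg_cst (1 : R)) (cvgM h (@cvg_harmonic R)).
  by rewrite mulr0 addr0 in h1; exact: h1.
have low : q m / expR (kappa m) @[m --> \oo] --> l.
  have h1 := cvgM h (cvgV (oner_neq0 R) ek).
  by rewrite invr1 mulr1 in h1; exact: h1.
apply: (@squeeze_cvgr _ _ _ _ (fun m => q m / expR (kappa m)) q) => //.
apply: nearW => m; apply/andP; split; last first.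
  rewrite /q ler_pM2r ?invr_gt0//; have := expR_ge1Dx (kappa m); lra.
rewrite /q mulrAC ler_pM2r ?invr_gt0// ler_pdivrMr ?expR_gt0//.
exact: expR_sub1_le.
Qed.

End LimitRates.

(** * Limits along one sequence of horizons and meshes *)

Section Asymptotics.
Context {d} {Omega : measurableType d} {R : realType} (P : probability Omega R)
  {n : nat} (X : 'I_n -> R -> Omega -> R) (phi : ('I_n -> R) -> R)
  (Zs : 'I_n -> Omega -> R).
Hypothesis inp : levy_input P X phi.
Hypothesis n1 : (0 < n)%N.
Hypothesis mean_neg : (\int[P]_w (Ysum X n.-1 1 w)%:E < 0)%E.
Hypothesis nz : forall i : 'I_n, (0 < i)%N -> ~ identically_zero_coord P X i.
Hypothesis mZs : forall i, measurable_fun setT (Zs i).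
Hypothesis ssZ : linear_steady_state P X Zs.

Let i0 := Ordinal n1.
Let i00 : val i0 = 0%N. Proof. by []. Qed.
Let lastn : (n.-1 < n)%N. Proof. by rewrite prednK. Qed.
Let il := Ordinal lastn.
Let mX := input_measurable _ _ _ inp.
Let Y w := \sum_i X i 1 w.

Let mY : measurable_fun setT Y.
Proof. by apply: measurable_sum => i; exact: mX. Qed.

Let laplaceY b : 0 <= b ->
  P.-integrable setT (EFin \o (fun w => expR (- (b * Y w)))) /\
  \int[P]_w expR (- (b * Y w)) = expR (phi (fun _ => b)).
Proof.
move=> b0; have := laplace_input P X phi inp (fun _ => b) 1 (fun _ => b0) ler01.
by rewrite mulr1; under [fun w => expR _]funext => w do rewrite -mulr_sumr.
Qed.

(** The negative part is dominated by [expR (- Y w)]. With it finite, an infinite positive part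
    would make the mean [+oo], contrary to its sign. *)
Lemma integrable_Ysum : P.-integrable setT (EFin \o Y).
Proof.
have mEY : measurable_fun setT (EFin \o Y) by exact/measurable_EFinP.
have [iE _] := laplaceY 1 ler01.
have iN : (\int[P]_w (EFin \o Y)^\- w < +oo)%E.
  have /integrableP[_] := iE; apply: le_lt_trans; apply: ge0_le_integral => //.
  - exact: measurable_funeneg.
  - by apply: measurableT_comp => //; have /integrableP[] := iE.
  - move=> w _; rewrite funenegE /= -EFin_max lee_fin.
    rewrite ger0_norm ?expR_ge0// ge_max expR_ge0 andbT mul1r.
    by have := expR_ge1Dx (- Y w); lra.
have iP : (\int[P]_w (EFin \o Y)^\+ w < +oo)%E.
  rewrite ltey; apply/eqP => h; move: mean_neg.
  under eq_integral => w _ do rewrite (Ysum_last X n1).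
  have N0 : (0 <= \int[P]_w (EFin \o Y)^\- w)%E.
    by apply: integral_ge0 => w _; exact: funeneg_ge0.
  rewrite integralE h; move: iN N0; case: (\int[P]_w _ ^\- w)%E => [r| |]//=.
apply/integrableP; split => //.
rewrite (_ : \int[P]_w _ = \int[P]_w (EFin \o Y)^\+ w + \int[P]_w (EFin \o Y)^\- w)%E.
  exact: lte_add_pinfty.
rewrite -ge0_integralD//; [|exact: measurable_funepos|exact: measurable_funeneg].
by rewrite -[LHS]/(\int[P]_w (abse \o (EFin \o Y)) w)%E fune_abse.
Qed.

(** Dominated convergence differentiates the transform of [Y] at 0 along [b = 1 / (m + 1)];
    [exponent_quotient_cvg] then passes from the transform to the exponent. *)
Lemma laplace_exponent_slope :
  phi (fun _ => m.+1%:R^-1) / m.+1%:R^-1 @[m --> \oo] -->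
  - fine (\int[P]_w (Ysum X n.-1 1 w)%:E).
Proof.
apply: (exponent_quotient_cvg (fun m => phi (fun _ => m.+1%:R^-1))).
have -> : - fine (\int[P]_w (Ysum X n.-1 1 w)%:E) = \int[P]_w (- Y w).
  under eq_integral => w _ do rewrite (Ysum_last X n1).
  under [RHS]eq_Rintegral => w _ do rewrite -mulN1r.
  by rewrite (RintegralZl _ measurableT integrable_Ysum) mulN1r.
have b0 m : 0 <= (m.+1%:R^-1 : R) by rewrite invr_ge0.
have -> : (fun m => (expR (phi (fun _ => m.+1%:R^-1)) - 1) / m.+1%:R^-1) =
    (fun m => \int[P]_w ((expR (- (m.+1%:R^-1 * Y w)) - 1) / m.+1%:R^-1)).
  apply/funext => m; have [iE E] := laplaceY _ (b0 m).
  have i1 := cst_integrable P (1 : R).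
  rewrite (RintegralZr _ measurableT (integrableB measurableT iE i1)).
  by rewrite RintegralB// E Rintegral_prob_cst.
have [i2 _] := laplaceY 2 (ler0n R 2).
apply: (Rintegral_dominated P _ _ (fun w => `|Y w| + expR (- (2 * Y w)))).
- move=> m; apply: measurable_funM => //; apply: measurable_funB => //.
  by apply: measurableT_comp => //; apply: measurable_funN; exact: measurable_funM.
- by move=> w; exact: diff_quotient_cvg.
- exact: (integrableD measurableT (integrable_norm integrable_Ysum) i2).
- by move=> m w; apply: diff_quotient_bound => //; rewrite invf_le1// ler1n.
Qed.

(** The gap vanishes only for a fixed horizon, so the mesh is picked for each [K] with mean gap at
    most [1 / (K + 1)]. The condition [K <= mK K] carries [mK K] past the threshold of
    [asymptotic_identity]. *)
Lemma grid_choice : exists mK : nat -> nat, [/\ forall K, (0 < mK K)%N,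
  (forall K, (K <= mK K)%N) &
  mean_gap P X ((mK K)%:R^-1) (K * mK K) @[K --> \oo] --> (0 : R)].
Proof.
have H K : exists m, [/\ (0 < m)%N, (K <= m)%N &
    `|mean_gap P X (m%:R^-1) (K * m)| <= K.+1%:R^-1].
  have e0 : 0 < (K.+1%:R^-1 : R) by rewrite invr_gt0.
  have /cvgrPdist_le /(_ _ e0) [M _ hM] := mean_gap_cvg P X phi i0 inp i00 K.
  exists (maxn M K.+1); split; [by rewrite leq_max ltn0Sn orbT| |].
    by rewrite leq_max leqnSn orbT.
  rewrite -normrN -sub0r; apply: hM => /=; exact: leq_maxl.
have [mK hK] := choice H.
exists mK; split; [by move=> K; have [] := hK K|by move=> K; have [] := hK K|].
apply: norm_cvg0.
apply: (@squeeze_cvgr _ _ _ _ (fun _ => 0) (fun K => K.+1%:R^-1)).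
- by apply: nearW => K; rewrite normr_ge0/=; have [] := hK K.
- exact: cvg_cst.
- exact: cvg_harmonic.
Qed.

Context (mK : nat -> nat).
Hypothesis mK0 : forall K, (0 < mK K)%N.
Hypothesis mKK : forall K, (K <= mK K)%N.
Hypothesis gap0 : mean_gap P X ((mK K)%:R^-1) (K * mK K) @[K --> \oo] --> (0 : R).

Lemma avg_lindley_stationary alpha : (forall k : nat, 0 <= tailn alpha k) ->
  avg_lindley P X alpha K (mK K) @[K --> \oo] --> stationary_laplace P Zs alpha.
Proof.
move=> ta; have /andP[L0 L1] := stationary_laplace_bound P Zs mZs alpha.
apply: (avg_lindley_cvg P X phi inp) => //.
exact: (mean_Zref_exp_cvg P X phi Zs inp mZs ssZ).
Qed.

Lemma asymptotic_identity_cvg alpha : (forall k : nat, 0 <= tailn alpha k) ->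
  phit phi alpha * avg_lindley P X alpha K (mK K) -
  \sum_i alpha i * avg_pushing P X alpha i K (mK K) @[K --> \oo] --> (0 : R).
Proof.
move=> ta; apply/cvgrPdist_le => eps eps0.
have e20 : 0 < eps / 2 by rewrite divr_gt0.
have [M _ hM] := asymptotic_identity P X phi i0 inp i00 alpha (eps / 2) ta e20.
near=> K; rewrite sub0r normrN.
have K0 : (0 < K)%N by near: K; exact: nbhs_infty_gt.
have MK : (M <= K)%N by near: K; exact: nbhs_infty_ge.
apply: le_trans (hM (mK K) (leq_trans MK (mKK K)) K K0) _.
have : K%:R^-1 <= eps / 2.
  rewrite invf_ple ?posrE ?ltr0n//; near: K; exact: nbhs_infty_ger.
lra.
Unshelve. all: by end_near. Qed.

Lemma weighted_pushing_cvg alpha : (forall k : nat, 0 <= tailn alpha k) ->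
  \sum_i alpha i * avg_pushing P X alpha i K (mK K) @[K --> \oo] -->
  phit phi alpha * stationary_laplace P Zs alpha.
Proof.
move=> ta; have h := asymptotic_identity_cvg alpha ta.
have hl := avg_lindley_stationary alpha ta.
rewrite -[X in _ --> X]subr0.
have -> : (fun K => \sum_i alpha i * avg_pushing P X alpha i K (mK K)) =
    (fun K => phit phi alpha * avg_lindley P X alpha K (mK K) -
      (phit phi alpha * avg_lindley P X alpha K (mK K) -
        \sum_i alpha i * avg_pushing P X alpha i K (mK K))).
  by apply/funext => K; rewrite opprB addrCA subrr addr0.
by apply: cvgB => //; apply: cvgM => //; exact: cvg_cst.
Qed.

Lemma avg_pushing_eq alpha alpha' (i : nat) K m :
  (forall l : 'I_n, (i < l)%N -> alpha l = alpha' l) ->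
  avg_pushing P X alpha i K m = avg_pushing P X alpha' i K m.
Proof.
move=> aa; apply: (congr1 (fun z => z / K%:R)); apply: eq_bigr => j _.
apply: eq_Rintegral => w _; rewrite /pushing_exp; congr (expR (- _) * _).
by apply: eq_bigr => l il'; rewrite aa.
Qed.

Let last_coord (b : R) : 'I_n -> R := fun i => if i == il then b else 0.

Let last_coord_tail b (k : nat) : tailn (last_coord b) k = if (k <= n.-1)%N then b else 0.
Proof.
rewrite /tailn big_mkcond (bigD1 il)//= big1 ?addr0.
  by rewrite /last_coord eqxx.
by move=> l lil; rewrite /last_coord (negbTE lil) if_same.
Qed.

Let last_coord_sum b (F : 'I_n -> R) : \sum_i last_coord b i * F i = b * F il.
Proof.
rewrite (bigD1 il)//= big1 ?addr0; first by rewrite /last_coord eqxx.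
by move=> l lil; rewrite /last_coord (negbTE lil) mul0r.
Qed.

Lemma last_pushing_cvg alpha :
  avg_pushing P X alpha n.-1 K (mK K) @[K --> \oo] -->
  - fine (\int[P]_w (Ysum X n.-1 1 w)%:E).
Proof.
pose ell b := phi (fun _ => b) / b * stationary_laplace P Zs (last_coord b).
have H b : 0 < b -> avg_pushing P X alpha n.-1 K (mK K) @[K --> \oo] --> ell b.
  move=> b0; have ta k : 0 <= tailn (last_coord b) k.
    by rewrite last_coord_tail; case: ifP => // _; exact: ltW.
  have := weighted_pushing_cvg (last_coord b) ta.
  rewrite (_ : phit phi (last_coord b) = phi (fun _ => b)); last first.
    rewrite /phit; congr phi; apply/funext => i; rewrite /tailv last_coord_tail.
    by rewrite -ltnS prednK// ltn_ord.
  under [X in X @ _]funext => K.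
    rewrite last_coord_sum (avg_pushing_eq _ alpha); last first.
      by move=> l /= h; have := ltn_ord l; rewrite -[n in (_ < n)%N](prednK n1) ltnS leqNgt h.
  over.
  move=> h; have -> : ell b =
      b^-1 * (phi (fun _ => b) * stationary_laplace P Zs (last_coord b)).
    by rewrite /ell mulrA [b^-1 * _]mulrC.
  have -> : (fun K => avg_pushing P X alpha n.-1 K (mK K)) =
      (fun K => b^-1 * (b * avg_pushing P X alpha il K (mK K))).
    by apply/funext => K; rewrite mulKf ?gt_eqF.
  by apply: cvgM; [exact: cvg_cst|exact: h].
(* The same sequence converges to [ell b] for every [b > 0], so [ell] is constant; its value is
   found by letting [b] tend to 0, with no interchange of the limits in [K] and [b]. *)
have -> : - fine (\int[P]_w (Ysum X n.-1 1 w)%:E) = ell 1; last exact: H.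
have b0 m : 0 < (m.+1%:R^-1 : R) by rewrite invr_gt0.
have c1 : ell m.+1%:R^-1 @[m --> \oo] --> ell 1.
  have -> : (fun m => ell m.+1%:R^-1) = (fun _ => ell 1); last exact: cvg_cst.
  by apply/funext => m; apply: (cvg_unique _ (H _ (b0 m)) (H 1 ltr01)).
suff c2 : ell m.+1%:R^-1 @[m --> \oo] -->
    - fine (\int[P]_w (Ysum X n.-1 1 w)%:E) * \int[P]_w (1 : R).
  by rewrite Rintegral_prob_cst mulr1 in c2; exact: (cvg_unique _ c2 c1).
apply: cvgM; first exact: laplace_exponent_slope.
apply: (Rintegral_dominated P _ _ (fun _ => 1)).
- move=> m; apply: measurableT_comp => //; apply: measurable_funN.
  apply: measurable_maxr => //; apply: measurable_sum => i.
  by apply: measurable_funM => //.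
- move=> w.
  have lin0 : - Num.max 0 (\sum_i last_coord m.+1%:R^-1 i * Zs i w) @[m --> \oo] --> (0 : R).
    have -> : (fun m => - Num.max 0 (\sum_i last_coord m.+1%:R^-1 i * Zs i w)) =
        (fun m => m.+1%:R^-1 * - Num.max 0 (Zs il w)).
      apply/funext => m; rewrite last_coord_sum mulrN; congr (- _).
      by rewrite maxr_pMr ?mulr0// ltW.
    rewrite -[X in _ --> X](mul0r (- Num.max 0 (Zs il w))).
    by apply: cvgM; [exact: cvg_harmonic|exact: cvg_cst].
  by rewrite -[X in _ --> X]expR0; exact: (cvg_comp _ _ lin0 (@continuous_expR R 0)).
- exact: cst_integrable.
- move=> m w; rewrite ger0_norm ?expR_ge0// -expR0 ler_expR oppr_le0.
  by rewrite le_max lexx.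
Qed.

Context (alpha : 'I_n -> R).
Hypothesis ta : forall k : nat, 0 <= tailn alpha k.
Hypothesis den : forall k : nat, (1 <= k < n)%N -> fden phi alpha k != 0.

Let fn := - fine (\int[P]_w (Ysum X n.-1 1 w)%:E).

(* Replacing alpha_1, ..., alpha_k by 0, ..., 0, psi_k - (alpha_{k+1} + ... +
   alpha_n) makes the exponent vanish and leaves the terms of index > k alone. *)
Lemma pushing_cvg (i : 'I_n) :
  avg_pushing P X alpha i K (mK K) @[K --> \oo] --> flow phi fn alpha i.
Proof.
have [e] := ubnP (n - i)%N; elim: e i => // e IH i ie.
rewrite /flow; case: ltnP => iN; last first.
  have -> : val i = n.-1.
    by apply/eqP; rewrite -eqSS prednK// eqn_leq iN andbT; exact: ltn_ord.
  exact: last_pushing_cvg.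
set k := i.+1 in iN *.
have tg (l : 'I_n) : (k <= l)%N -> 0 <= tailv alpha l by move=> _; exact: ta.
have [psi0 psiE] := psiP P X phi inp n1 mean_neg k (tailv alpha) (ltn0Sn i) tg nz.
set b := psi phi k (tailv alpha) in psi0 psiE.
(* Its tail sums equal [b] up to index [i] and those of [alpha] beyond. As [i] is counted from 0,
   these are the [k = i.+1] copies of the root. *)
pose a' : 'I_n -> R := fun l =>
  if (l < i)%N then 0 else if l == i then b - tailn alpha k else alpha l.
have a'i : a' i = b - tailn alpha k by rewrite /a' ltnn eqxx.
have a'gt (l : 'I_n) : (i < l)%N -> a' l = alpha l.
  move=> il'; rewrite /a' ltnNge (ltnW il')/=; case: eqP => // li.
  by rewrite li ltnn in il'.
have tk (j : nat) : (k <= j)%N -> tailn a' j = tailn alpha j.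
  by move=> kj; apply: eq_bigr => l jl; apply: a'gt; exact: leq_trans jl.
have ti : tailn a' i = b by rewrite /tailn sum_ord_geS -/(tailn a' k) tk// a'i subrK.
have tlt (j : nat) : (j <= i)%N -> tailn a' j = b.
  move=> ji; rewrite -ti /tailn [LHS]big_mkcond [RHS]big_mkcond/=.
  apply: eq_bigr => l _; case: (leqP i l) => il'; first by rewrite (leq_trans ji).
  by rewrite /a' il' if_same.
have ta' (j : nat) : 0 <= tailn a' j.
  by have [/tlt ->//|/tk ->] := leqP j i.
have ph0 : phit phi a' = 0.
  rewrite -psiE /phit; congr phi; apply/funext => l; rewrite /tailv.
  by rewrite ltnS; case: leqP => li; [exact: tlt|exact: tk].
have := weighted_pushing_cvg a' ta'; rewrite ph0 mul0r.
under [X in X @ _]funext => K.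
  rewrite (bigID (fun l : 'I_n => (i <= l)%N))/= [X in _ + X]big1 ?addr0; last first.
    by move=> l; rewrite -ltnNge => li; rewrite /a' li mul0r.
  rewrite sum_ord_geS a'i (avg_pushing_eq a' alpha i); last by move=> l; exact: a'gt.
  rewrite (eq_bigr (fun l : 'I_n => alpha l * avg_pushing P X alpha l K (mK K))); last first.
    move=> l il'; rewrite (a'gt l il') (avg_pushing_eq a' alpha l)//.
    by move=> l' ll'; apply: a'gt; exact: ltn_trans ll'.
over.
move=> hw.
have hs : \sum_(l < n | (i < l)%N) alpha l * avg_pushing P X alpha l K (mK K) @[K --> \oo]
    --> fnum phi fn alpha (n - k).
  rewrite (fnumE _ _ _ _ (ltnW iN)).
  under [X in X @ _]funext => K do rewrite big_mkcond.
  rewrite big_mkcond; apply: cvg_big_sum => l; case: ifP => il'; last exact: cvg_cst.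
  apply: cvgM; first exact: cvg_cst.
  by apply: IH; rewrite -ltnS; apply: leq_trans ie; rewrite ltnS ltn_sub2l.
have hd : fden phi alpha k != 0 by apply: den; rewrite iN.
have h3 := cvgB hs hw; rewrite subr0 in h3.
(* In the combination that tends to 0, the rate [i] has weight [b - tailn alpha k], which is
   [- fden phi alpha k]. Solving for the rate expresses it through convergent sequences and so
   proves that it converges. *)
have -> : (fun K => avg_pushing P X alpha i K (mK K)) = (fun K =>
    (\sum_(l < n | (i < l)%N) alpha l * avg_pushing P X alpha l K (mK K) -
     ((b - tailn alpha k) * avg_pushing P X alpha i K (mK K) +
      \sum_(l < n | (i < l)%N) alpha l * avg_pushing P X alpha l K (mK K))) *
    (fden phi alpha k)^-1).
  apply/funext => K; move: hd; rewrite /fden -/b.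
  move: (\sum_(l < n | _) _) (avg_pushing _ _ _ _ _ _) (tailn alpha k) => x1 x2 x3 hd.
  by field.
by apply: cvgM; [exact: h3|exact: cvg_cst].
Qed.

Lemma steady_state_identity :
  phit phi alpha * stationary_laplace P Zs alpha = rhs phi fn alpha.
Proof.
apply: (cvg_unique _ (weighted_pushing_cvg alpha ta)) => //.
rewrite rhsE//; apply: cvg_big_sum => i; apply: cvgM; first exact: cvg_cst.
exact: pushing_cvg.
Qed.

End Asymptotics.

(** * Removing null sets *)

Section Regularization.
Context {d} {Omega : measurableType d} {R : realType} (P : probability Omega R)
  {n : nat} (X : 'I_n -> R -> Omega -> R) (phi : ('I_n -> R) -> R) (N : set Omega).
Hypothesis mN : measurable N.
Hypothesis PN : P N = 0%E.
Hypothesis levyX : levy_process P X.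
Hypothesis lapX : laplace_exponent P X phi.
Hypothesis good : forall w, ~ N w ->
  (forall i : 'I_n, (0 < i)%N -> nondecreasing_on_Rplus (fun t => X i t w)) /\
  (forall i : 'I_n, val i = 0%N -> no_negative_jumps (fun t => X i t w)).

Lemma prob_eq_off_null (A A' : set Omega) : measurable A -> measurable A' ->
  (forall w, ~ N w -> A w <-> A' w) -> P A = P A'.
Proof.
move=> mA mA' AA'; apply/eqP; rewrite eq_le.
have le B B' : measurable B -> measurable B' -> (forall w, ~ N w -> B w -> B' w) ->
    (P B <= P B')%E.
  move=> mB mB' BB'; rewrite -[leRHS]adde0 -PN.
  apply: le_trans (_ : P (B' `|` N) <= _)%E; last exact: measureU2.
  apply: le_measure; rewrite ?inE//; first exact: measurableU.
  by move=> w Bw; have [Nw|/BB' h] := pselect (N w); [right|left; exact: h].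
by rewrite !le// => w Nw h; apply/(AA' w Nw).
Qed.

(* Killing the process on a null set makes its almost sure path properties hold
   for every path. *)
Definition regularized (i : 'I_n) (t : R) (w : Omega) : R := \1_(~` N) w * X i t w.

Lemma regularized_off i t w : ~ N w -> regularized i t w = X i t w.
Proof. by move=> Nw; rewrite /regularized indicE mem_set// mul1r. Qed.

Lemma regularized_on i t w : N w -> regularized i t w = 0.
Proof. by move=> Nw; rewrite /regularized indicE memNset ?mul0r//=; exact. Qed.

Let path_off i w : ~ N w -> (fun t => regularized i t w) = (fun t => X i t w).
Proof. by move=> Nw; apply/funext => t; exact: regularized_off. Qed.

Let path_on i w : N w -> (fun t => regularized i t w) = (fun=> 0).
Proof. by move=> Nw; apply/funext => t; exact: regularized_on. Qed.

Let mX i t : measurable_fun setT (X i t). Proof. by case: levyX. Qed.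

Lemma measurable_regularized i t : measurable_fun setT (regularized i t).
Proof.
apply: measurable_funM; last exact: mX.
by apply: measurable_indic; exact: measurableC.
Qed.

Lemma aeN (Q : Omega -> Prop) : (forall w, ~ N w -> Q w) -> {ae P, forall w, Q w}.
Proof.
move=> h; exists N; split => // w /= nQ; apply: contrapT => Nw; exact: nQ (h w Nw).
Qed.

Let measurable_rect (F : 'I_n -> Omega -> R) (B : 'I_n -> set R) :
  (forall i, measurable_fun setT (F i)) -> (forall i, measurable (B i)) ->
  measurable [set w | forall i, B i (F i w)].
Proof.
move=> mF mB; rewrite (_ : [set _ | _] = \bigcap_i (F i @^-1` B i)).
  apply: fin_bigcap_measurable => // i _.
  by rewrite -[X in measurable X]setTI; exact: mF.
by apply/seteqP; split => w /= h i; [move=> _|]; exact: h.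
Qed.

Let rect_eq (u v : 'I_n -> R) (B : 'I_n -> set R) : (forall i, measurable (B i)) ->
  P [set w | forall i, B i (regularized i (u i) w - regularized i (v i) w)] =
  P [set w | forall i, B i (X i (u i) w - X i (v i) w)].
Proof.
move=> mB; apply: prob_eq_off_null.
- apply: (measurable_rect (fun i w => regularized i (u i) w - regularized i (v i) w)) => // i.
  by apply: measurable_funB; exact: measurable_regularized.
- apply: (measurable_rect (fun i w => X i (u i) w - X i (v i) w)) => // i.
  exact: measurable_funB.
- by move=> w Nw; split => h i; have := h i; rewrite !regularized_off.
Qed.

Lemma levy_input_regularized : levy_input P regularized phi.
Proof.
have [_ X0 Xc Xs Xi] := levyX.
have reg0 i w : regularized i 0 w = 0 by rewrite /regularized X0 mulr0.
split => //.
- exact: measurable_regularized.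
- move=> i w; have [Nw|Nw] := pselect (N w).
    by rewrite path_on//; exact: cadlag0.
  by rewrite path_off.
- move=> s t s0 t0 B mB; rewrite (rect_eq (fun _ => s + t) (fun _ => s)) //.
  rewrite (Xs s t s0 t0 B mB); have := rect_eq (fun _ => t) (fun _ => 0) B mB.
  have incr0 (X' : 'I_n -> R -> Omega -> R) : (forall i w, X' i 0 w = 0) ->
      [set w | forall i, B i (X' i t w - X' i 0 w)] = [set w | forall i, B i (X' i t w)].
    by move=> X'0; apply/seteqP; split => w h i; have := h i; rewrite /= X'0 subr0.
  by rewrite !incr0.
- move=> m t t0 tm B mB.
  transitivity (P (\bigcap_(j in [set: 'I_m])
      [set w | forall i, B j i (X i (t j.+1) w - X i (t j) w)])).
    apply: prob_eq_off_null.
    + apply: fin_bigcap_measurable => // j _.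
      apply: (measurable_rect
        (fun i w => regularized i (t j.+1) w - regularized i (t j) w)) => // i.
      by apply: measurable_funB; exact: measurable_regularized.
    + apply: fin_bigcap_measurable => // j _.
      apply: (measurable_rect (fun i w => X i (t j.+1) w - X i (t j) w)) => // i.
      exact: measurable_funB.
    + by move=> w Nw; split => h j _ i; have := h j I i; rewrite !regularized_off.
  rewrite (Xi m t t0 tm B mB); apply: eq_bigr => j _; apply/esym.
  exact: (rect_eq (fun _ => t j.+1) (fun _ => t j)).
- move=> i i0 w; have [Nw|Nw] := pselect (N w).
    by move=> s t _ _; rewrite !regularized_on.
  by move=> s t s0 st; rewrite !regularized_off//; apply: (good w Nw).1.
- move=> i i0 w; have [Nw|Nw] := pselect (N w).
    by rewrite path_on// => t _; rewrite (cvg_lim _ (cvg_cst 0)).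
  by rewrite path_off//; exact: (good w Nw).2.
- move=> a a0 t t0; rewrite -(lapX a a0 t t0); apply: ae_eq_integral => //.
  + apply/measurable_EFinP; apply: measurableT_comp => //; apply: measurable_funN.
    apply: measurable_sum => i; apply: measurable_funM => //; exact: measurable_regularized.
  + apply/measurable_EFinP; apply: measurableT_comp => //; apply: measurable_funN.
    by apply: measurable_sum => i; apply: measurable_funM.
  + apply: aeN => w Nw _ /=; congr ((expR (- _))%:E); apply: eq_bigr => i _.
    by rewrite regularized_off.
Qed.

Lemma Ysum_regularized k t w : ~ N w -> Ysum regularized k t w = Ysum X k t w.
Proof. by move=> Nw; apply: eq_bigr => i _; rewrite regularized_off. Qed.

Lemma mean_Ysum_regularized k t :
  (\int[P]_w (Ysum regularized k t w)%:E = \int[P]_w (Ysum X k t w)%:E)%E.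
Proof.
apply: ae_eq_integral => //.
- apply/measurable_EFinP; apply: measurable_sum_cond => i _; exact: measurable_regularized.
- by apply/measurable_EFinP; apply: measurable_sum_cond => i _.
- by apply: aeN => w Nw _ /=; rewrite Ysum_regularized.
Qed.

Lemma Zref_regularized k t w : ~ N w -> Zref regularized k t w = Zref X k t w.
Proof.
move=> Nw; rewrite /Zref Ysum_regularized//; congr (_ - inf _).
by apply: eq_imagel => s _; rewrite Ysum_regularized.
Qed.

Lemma steady_state_regularized Zs : linear_steady_state P X Zs ->
  linear_steady_state P regularized Zs.
Proof.
have [_ _ Xc _ _] := levyX.
move=> ssZ alpha G M Gc GM; have := ssZ alpha G M Gc GM.
apply: cvg_trans; apply: near_eq_cvg; near=> t.
have t0 : 0 <= t by near: t; exact: nbhs_pinfty_ge.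
have mlin X' : (forall i t, measurable_fun setT (X' i t)) ->
    (forall (i : 'I_n) w, cadlag (fun t => X' i t w)) ->
    measurable_fun setT (EFin \o (fun w => G (\sum_i alpha i * Zref X' i t w))).
  move=> mX' X'c; apply/measurable_EFinP; apply: measurableT_comp.
    exact: continuous_measurable_fun.
  by apply: measurable_sum => i; apply: measurable_funM => //; exact: measurable_Zref.
apply: ae_eq_integral => //; first exact: mlin.
  apply: mlin; first exact: measurable_regularized.
  exact: input_cadlag _ _ _ levy_input_regularized.
apply: aeN => w Nw _ /=; congr ((G _)%:E); apply: eq_bigr => i _.
by rewrite Zref_regularized.
Unshelve. all: by end_near. Qed.

Lemma zero_coord_regularized i : identically_zero_coord P regularized i ->
  identically_zero_coord P X i.
Proof.
move=> h t t0; have := aeN (fun w => regularized i t w = X i t w)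
  (fun w => regularized_off i t w).
by apply: filterS2 (h t t0) => w <- ->.
Qed.

End Regularization.

Theorem theorem1 (R : realType) (d : measure_display) (Omega : measurableType d)
  (P : probability Omega R) (n : nat) (X : 'I_n -> R -> Omega -> R)
  (phi : ('I_n -> R) -> R) (Zs : 'I_n -> Omega -> R) :
  (2 <= n)%N ->
  levy_process P X ->
  (forall i : 'I_n, val i = 0%N ->
     no_negative_jumps_coord P X i /\ ~ subordinator_coord P X i) ->
  (forall i : 'I_n, (0 < val i)%N ->
     subordinator_coord P X i /\ ~ identically_zero_coord P X i) ->
  laplace_exponent P X phi ->
  (\int[P]_w (Ysum X n.-1 1 w)%:E < 0)%E ->
  (forall i, measurable_fun setT (Zs i)) ->
  steady_state P X Zs ->
  let fn := - fine (\int[P]_w (Ysum X n.-1 1 w)%:E) in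
  forall alpha : 'I_n -> R,
    (forall k : 'I_n, 0 <= tailn alpha k) ->
    (forall k : nat, (1 <= k < n)%N -> fden phi alpha k != 0) ->
    ((phit phi alpha)%:E * \int[P]_w (expR (- \sum_i alpha i * Zs i w))%:E
       = (rhs phi fn alpha)%:E)%E.
Proof.
move=> n2 levyX first_coord rest lapX mean_neg mZs ssZ fn alpha ta0 den.
have n1 : (0 < n)%N by exact: leq_trans n2.
have ta (k : nat) : 0 <= tailn alpha k.
  have [nk|kn] := leqP n k; last exact: (ta0 (Ordinal kn)).
  by rewrite /tailn sum_ord_ge_oversize.
(* Finitely many coordinates, so one null set carries all exceptional paths. *)
have : {ae P, forall w, forall i : 'I_n,
    ((0 < i)%N -> nondecreasing_on_Rplus (fun t => X i t w)) /\
    (val i = 0%N -> no_negative_jumps (fun t => X i t w))}.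
  apply: filter_forall => i; case: (posnP i) => i0.
    by apply: filterS (first_coord i i0).1 => w h; split => //; rewrite i0.
  by apply: filterS (rest i i0).1 => w h; split => // i00; rewrite i00 in i0.
case=> N [mN PN subN].
have good w : ~ N w ->
    (forall i : 'I_n, (0 < i)%N -> nondecreasing_on_Rplus (fun t => X i t w)) /\
    (forall i : 'I_n, val i = 0%N -> no_negative_jumps (fun t => X i t w)).
  move=> Nw; have h : forall i : 'I_n,
      ((0 < i)%N -> nondecreasing_on_Rplus (fun t => X i t w)) /\
      (val i = 0%N -> no_negative_jumps (fun t => X i t w)).
    by apply: contrapT => h; apply: Nw; exact: subN.
  by split => i; have [] := h i.
have inp := levy_input_regularized P X phi N mN PN levyX lapX good.
have nz (i : 'I_n) : (0 < i)%N -> ~ identically_zero_coord P (regularized X N) i.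
  by move=> i0 /(zero_coord_regularized P X N mN PN); exact: (rest i i0).2.
have ss := steady_state_regularized P X phi N mN PN levyX lapX good Zs
  (steady_state_linear P X Zs ssZ).
have mYE := mean_Ysum_regularized P X N mN PN levyX n.-1 1.
rewrite -mYE in mean_neg; rewrite /fn -mYE.
(* The argument runs on the regularized process, with the same [phi], [Zs] and mean of the total
   sum. *)
have [mK [mK0 mKK gap0]] := grid_choice P (regularized X N) phi inp n1.
rewrite (steady_state_laplace P _ phi Zs inp mZs ss alpha ta) -EFinM; congr (_%:E).
exact: (steady_state_identity P _ phi Zs inp n1 mean_neg nz mZs ss mK mK0 mKK gap0).
Qed.
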